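(* Let $H$ be a commutative hypergroup with Haar measure $\lambda$, let $\widehat{H}$ be its dual space equipped with the Plancherel measure $\pi$. Let $1<p\leq 2$, and let $1<p\leq b\leq p'\leq\infty$, where $p'=\frac{p}{p-1}$. There is a constant $C>0$, independent of $\psi$ and $f$, such that the following holds. If $\psi$ is a positive measurable function on $\widehat{H}$ such that $$M_\psi := \sup_{t>0}\, t \int_{\{\chi\in\widehat{H}\,:\,\psi(\chi)\geq t\}} d\pi(\chi)$$ is finite, then for every $f\in L^p(H,d\lambda)$, $$\left( \int_{\widehat{H}} \left( |\widehat{f}(\chi)|\, \psi(\chi)^{\frac{1}{b}-\frac{1}{p'}} \right)^b d\pi(\chi) \right)^{\frac{1}{b}} \leq C\, M_\psi^{\frac{1}{b}-\frac{1}{p'}}\, \|f\|_{L^p(H,d\lambda)}.$$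
   Context: A hypergroup is a nonempty locally compact Hausdorff space $H$ with a weakly continuous, associative convolution $*$ on the Banach space $M(H)$ of bounded regular Borel measures on $H$, making $(M(H),* )$ a Banach algebra, such that: (i) for all $x,y\in H$, $\delta_x*\delta_y$ is a probability measure with compact support ($\delta_x$ is the point mass at $x$), and $(x,y)\mapsto \mathrm{supp}(\delta_x*\delta_y)$ is continuous from $H\times H$ to the space of nonempty compact subsets of $H$ with the Michael (Vietoris) topology; (ii) there is a unique $e\in H$ with $\delta_x*\delta_e=\delta_e*\delta_x=\delta_x$ for all $x$; (iii) there is a homeomorphism $x\mapsto\check{x}$ of $H$ of order two which induces an involution on $M(H)$, where $\check{\mu}(E)=\mu(\check{E})$ for Borel sets $E$, and $e\in\mathrm{supp}(\delta_x*\delta_y)$ if and only if $x=\check{y}$. $H$ is commutative if $*$ is commutative. Write $f(x*y)=\int_H f\,d(\delta_x*\delta_y)$. A Haar measure is a nonzero positive Radon measure $\lambda$ on $H$ with $\int_H f(x*y)\,d\lambda(y)=\int_H f(y)\,d\lambda(y)$ for all $x\in H$, $f\in C_c(H)$; it exists for commutative $H$ and is unique up to a scalar multiple. The dual space is $\widehat{H}=\{\chi : H\to\mathbb{C}\text{ bounded continuous}:\chi\neq0,\ \chi(\check{x})=\overline{\chi(x)},\ \chi(x*y)=\chi(x)\chi(y)\ \forall x,y\in H\}$, with the compact-open topology. The Fourier transform of $f\in L^1(H,\lambda)$ is $\widehat{f}(\chi)=\int_H f(x)\overline{\chi(x)}\,d\lambda(x)$. The Plancherel measure $\pi$ is the unique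 positive Borel measure on $\widehat{H}$ with $\int_H|f|^2d\lambda=\int_{\widehat{H}}|\widehat{f}|^2d\pi$ for all $f\in L^1(H,\lambda)\cap L^2(H,\lambda)$. For $1\le p\le2$, $\frac1p+\frac1{p'}=1$, the Hausdorff–Young inequality $\|\widehat{f}\|_{L^{p'}(\widehat{H},d\pi)}\le\|f\|_{L^p(H,d\lambda)}$ on $L^1\cap L^2$ is known, and $\widehat{f}$ for $f\in L^p(H,d\lambda)$ is defined by the resulting continuous extension. *)

(* Defs.v *)
From HB Require Import structures.
From mathcomp Require Import all_boot all_order all_algebra.
From mathcomp Require Import all_classical all_reals all_analysis.
From mathcomp Require Import complex.
Set Implicit Arguments.
Unset Strict Implicit.
Unset Printing Implicit Defensive.
Import Order.TTheory GRing.Theory Num.Theory.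
Import numFieldNormedType.Exports.
Import Normc.
Local Open Scope classical_set_scope.
Local Open Scope ring_scope.
Local Open Scope complex_scope.

(* [R[i]^o] is [R[i]] seen as a normed space over itself; only this alias
   carries the usual topology of the complex plane. *)

Notation borel T := (g_sigma_algebraType (@open T)).

Section complex_functions.
Context d (T : measurableType d) (R : realType).

(* Componentwise, i.e. Borel measurability into the complex plane. *)
Definition cmeasurable (f : T -> R[i]) :=
  measurable_fun setT (fun x => complex.Re (f x)) /\
  measurable_fun setT (fun x => complex.Im (f x)).

Definition cintegral (m : {measure set T -> \bar R}) (f : T -> R[i]) : R[i] :=
  Complex (\int[m]_x complex.Re (f x)) (\int[m]_x complex.Im (f x)).

Definition cnorm (m : {measure set T -> \bar R}) (p : R) (f : T -> R[i]) :
  \bar R := 'N[m]_p%:E[EFin \o (@normc R \o f)]%E.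

Definition cLp (m : {measure set T -> \bar R}) (p : R) (f : T -> R[i]) :=
  cmeasurable f /\ (cnorm m p f < +oo)%E.

End complex_functions.

Section measures.
Context (R : realType) (H : ptopologicalType).

Definition regular (m : set (borel H) -> \bar R) :=
  forall A : set (borel H), measurable A -> forall eps : R, 0 < eps ->
  exists F U : set H, [/\ compact F, open U, F `<=` A, A `<=` U &
                          (m (U `\` F) < eps%:E)%E].

Definition total_variation (mu : set (borel H) -> R[i])
    (A : set (borel H)) : \bar R :=
  ereal_sup [set s | exists (n : nat) (F : 'I_n -> set (borel H)),
    [/\ forall i, measurable (F i), trivIset setT F, forall i, F i `<=` A &
        s = (\sum_(i < n) normc (mu (F i)))%:E]].

(* The elements of M(H) are represented by set functions that vanish outside
   the Borel sets, so that equality of measures is [=] and the vector space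
   structure of M(H) is the pointwise one. *)
Definition bounded_regular (mu : set (borel H) -> R[i]) :=
  [/\ forall A : set (borel H), ~ measurable A -> mu A = 0,
      forall F : nat -> set (borel H),
        (forall n, measurable (F n)) -> trivIset setT F ->
        (fun n => \sum_(0 <= k < n) mu (F k) : R[i]^o) @ \oo -->
          (mu (\bigcup_n F n) : R[i]^o),
      (total_variation mu setT < +oo)%E &
      regular (total_variation mu)].

(* A finite positive measure seen as an element of M(H). *)
Definition cmeasure (m : set (borel H) -> \bar R) (A : set (borel H)) : R[i] :=
  if `[< measurable A >] then (fine (m A))%:C else 0.

Definition msupport (m : set (borel H) -> \bar R) : set H :=
  [set x | forall U : set H, open U -> U x -> (0 < m U)%E].

Definition finite_measures := {finite_measure set (borel H) -> \bar R}.
HB.instance Definition _ := gen_eqMixin finite_measures.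
HB.instance Definition _ := gen_choiceMixin finite_measures.

Definition bounded_continuous : set (H -> R) :=
  [set f | continuous f /\ exists M : R, forall x, `|f x| <= M].

Definition pairing (m : finite_measures) :
    {ptws bounded_continuous -> R} :=
  fun f => \int[m : finite_measures]_x (set_val f x).

Definition weak_measures := initial_topology pairing.

End measures.

Section michael.
Context (H : ptopologicalType).

Definition compacts := {A : set H | compact A /\ A !=set0}.
HB.instance Definition _ := gen_eqMixin compacts.
HB.instance Definition _ := gen_choiceMixin compacts.
HB.instance Definition _ := @isSubBaseTopological.Build compacts
  (set H * set H)%type
  [set UV | open UV.1 /\ open UV.2]
  (fun UV => [set A | sval A `&` UV.1 !=set0 /\ sval A `<=` UV.2]).

End michael.

Section hypergroup.
Context (R : realType) (H : ptopologicalType).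

Definition point_mass (x : H) : finite_measures R H :=
  (\d_(x : borel H) : {finite_measure set (borel H) -> \bar R}).

Notation M := (@bounded_regular R H).
Notation delta x := (cmeasure (point_mass x)).

Record hypergroup := Hypergroup {
  hg_hausdorff : hausdorff_space H;
  hg_locally_compact : locally_compact [set: H];
  (* (M(H), +, conv) is a Banach algebra; completeness of M(H) for the total
     variation norm does not involve the convolution. *)
  hg_conv : (set (borel H) -> R[i]) -> (set (borel H) -> R[i]) ->
    set (borel H) -> R[i];
  hg_conv_closed : forall mu nu, M mu -> M nu -> M (hg_conv mu nu);
  hg_conv_linearl : forall (a : R[i]) mu1 mu2 nu, M mu1 -> M mu2 -> M nu ->
    hg_conv (a *: mu1 + mu2) nu = a *: hg_conv mu1 nu + hg_conv mu2 nu;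
  hg_conv_linearr : forall (a : R[i]) mu nu1 nu2, M mu -> M nu1 -> M nu2 ->
    hg_conv mu (a *: nu1 + nu2) = a *: hg_conv mu nu1 + hg_conv mu nu2;
  hg_convA : forall mu1 mu2 mu3, M mu1 -> M mu2 -> M mu3 ->
    hg_conv mu1 (hg_conv mu2 mu3) = hg_conv (hg_conv mu1 mu2) mu3;
  hg_conv_norm : forall mu nu, M mu -> M nu ->
    (total_variation (hg_conv mu nu) setT <=
     total_variation mu setT * total_variation nu setT)%E;
  (* Weak continuity: on positive measures, where the convolution is again
     positive (and is then denoted by [hg_pconv]), it is jointly continuous for
     the weak topology; joint weak continuity on all of M(H) already fails for
     infinite groups. *)
  hg_pconv : finite_measures R H -> finite_measures R H -> finite_measures R H;
  hg_pconvE : forall m n : finite_measures R H, regular m -> regular n ->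
    hg_conv (cmeasure m) (cmeasure n) = cmeasure (hg_pconv m n);
  hg_pconv_continuous :
    {within [set mn : weak_measures R H * weak_measures R H |
             regular (mn.1 : finite_measures R H) /\
             regular (mn.2 : finite_measures R H)],
     continuous (fun mn => hg_pconv mn.1 mn.2 : weak_measures R H)};
  hg_probability : forall x y,
    (hg_pconv (point_mass x) (point_mass y) setT = 1)%E;
  hg_support : H * H -> compacts H;
  hg_supportE : forall x y, sval (hg_support (x, y)) =
    msupport (hg_pconv (point_mass x) (point_mass y));
  hg_support_continuous : continuous hg_support;
  hg_e : H;
  hg_conv_e : forall x,
    hg_conv (delta x) (delta hg_e) = delta x /\
    hg_conv (delta hg_e) (delta x) = delta x;
  hg_e_unique : forall e, (forall x, hg_conv (delta x) (delta e) = delta x /\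
    hg_conv (delta e) (delta x) = delta x) -> e = hg_e;
  hg_inv : H -> H;
  hg_inv_continuous : continuous hg_inv;
  hg_invK : involutive hg_inv;
  (* The image under [hg_inv] is an anti-automorphism of the algebra M(H). *)
  hg_inv_conv : forall mu nu, M mu -> M nu ->
    (fun A => hg_conv mu nu (hg_inv @` A)) =
    hg_conv (fun A => nu (hg_inv @` A)) (fun A => mu (hg_inv @` A));
  hg_inv_support : forall x y,
    msupport (hg_pconv (point_mass x) (point_mass y)) hg_e <-> x = hg_inv y
}.

Definition commutative_hypergroup (K : hypergroup) := forall mu nu,
  M mu -> M nu -> hg_conv K mu nu = hg_conv K nu mu.

(* f(x * y) *)
Definition hg_eval (K : hypergroup) (f : H -> R[i]) (x y : H) : R[i] :=
  cintegral (hg_pconv K (point_mass x) (point_mass y)) (f : borel H -> R[i]).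

(* Inner regularity is required on open sets only, as [lambda] need not be
   sigma-finite. *)
Definition radon (lambda : {measure set (borel H) -> \bar R}) :=
  [/\ forall F : set H, compact F -> (lambda F < +oo)%E,
      forall A : set (borel H), measurable A ->
        lambda A = ereal_inf [set lambda U | U in [set U : set H |
                                               open U /\ A `<=` U]] &
      forall U : set H, open U ->
        lambda U = ereal_sup [set lambda F | F in [set F : set H |
                                               compact F /\ F `<=` U]]].

Definition haar (K : hypergroup) (lambda : {measure set (borel H) -> \bar R}) :=
  [/\ radon lambda, (0 < lambda setT)%E &
      forall (x : H) (f : H -> R[i]), continuous (f : H -> R[i]^o) ->
        compact (closure [set y | f y != 0]) ->
        cintegral lambda (fun y => hg_eval K f x y) = cintegral lambda f].

End hypergroup.

Section dual.
Context (R : realType) (H : ptopologicalType) (K : hypergroup R H).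

Definition characters : set {compact-open, H -> R[i]^o} :=
  [set chi : H -> R[i] |
    [/\ continuous (chi : H -> R[i]^o),
        exists B : R, forall x, normc (chi x) <= B,
        exists x, chi x != 0,
        forall x, chi (hg_inv K x) = (chi x)^* &
        forall x y, hg_eval K chi x y = chi x * chi y]].

Lemma characters1 : characters (fun=> 1).
Proof.
split.
- by move=> x; exact: cvg_cst.
- by exists 1 => x; rewrite normc1.
- by exists point; rewrite oner_eq0.
- by move=> x; apply/eqP; rewrite eq_complex /= oppr0 !eqxx.
- move=> x y; rewrite mulr1 /hg_eval /cintegral /= !Rintegral_cst//.
  by rewrite mul0r mul1r; have /= -> := hg_probability K x y.
Qed.

(* [set_type] carries the topology induced by the compact-open one. *)
Definition dual : Type := characters.
HB.instance Definition _ := Topological.copy dual characters.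
HB.instance Definition _ := isPointed.Build dual (SigSub (mem_set characters1)).

Definition fourier (lambda : {measure set (borel H) -> \bar R})
    (f : H -> R[i]) (chi : dual) : R[i] :=
  cintegral lambda (fun x => f x * ((set_val chi : H -> R[i]) x)^*).

Definition plancherel (lambda : {measure set (borel H) -> \bar R})
    (pi : {measure set (borel dual) -> \bar R}) :=
  forall f : borel H -> R[i], cLp lambda 1 f -> cLp lambda 2 f ->
  (\int[lambda]_x (normc (f x) ^+ 2)%:E =
   \int[pi]_chi (normc (fourier lambda f chi) ^+ 2)%:E)%E.

(* [g] represents the Fourier transform of the element [f] of L^p: the
   continuous extension to L^p of [fourier] on the intersection of L^1 and L^2
   takes at [f] the value [g] in L^p', p' = p / (p - 1). *)
Definition fourier_Lp (lambda : {measure set (borel H) -> \bar R})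
    (pi : {measure set (borel dual) -> \bar R}) (p : R)
    (f : borel H -> R[i]) (g : borel dual -> R[i]) :=
  cLp pi (p / (p - 1)) g /\
  exists u : nat -> borel H -> R[i],
    [/\ forall n, cLp lambda 1 (u n) /\ cLp lambda 2 (u n),
        cnorm lambda p (fun x => u n x - f x) @[n --> \oo] --> 0%E &
        cnorm pi (p / (p - 1)) (fun chi => fourier lambda (u n) chi - g chi)
          @[n --> \oo] --> 0%E].

Definition weak_sup (pi : {measure set (borel dual) -> \bar R})
    (psi : dual -> R) : \bar R :=
  ereal_sup [set (t%:E * pi [set chi | (t <= psi chi)%R])%E |
    t in [set t : R | 0 < t]].

End dual.

(* Main.v *)
Require Import Defs.
From mathcomp Require Import all_boot all_order all_algebra.
From mathcomp Require Import all_classical all_reals all_analysis.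
From mathcomp Require Import measurable_realfun complex ring lra.
Set Implicit Arguments.
Unset Strict Implicit.
Unset Printing Implicit Defensive.
Import Order.TTheory GRing.Theory Num.Theory.
Import numFieldNormedType.Exports.
Import Normc.
Local Open Scope classical_set_scope.
Local Open Scope ring_scope.

(** Write [q = p / (p - 1)], [M] for the supremum attached to [psi], and [u^]
for the Fourier transform of [u].  For [u] in L^1 and L^2 everything follows
from two endpoint inequalities.

The endpoint [b = p] is Paley's inequality ([paley_le]): the integral of
[|u^|^p psi^(2-p)] is at most [C M^(2-p)] times the integral of [|u|^p].  It is
the Marcinkiewicz theorem for [u |-> u^ / psi] and the measure [psi^2 dpi], which
is of weak type (1,1) because [u^] is bounded by the L^1 norm of [u]
([normc_fourier_le]) and because the integral of [psi^2] over [psi <= v] is at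
most [4 M v] ([integral_sqr_sublevel]), and of type (2,2) by Plancherel.  The
interpolation is done by hand.  On the set where [|u^| / psi] is between [s] and
[2 s], for [s] a power of 2, cut [u] at height [M s].  Where the transform of the
low part dominates, Plancherel applies to that part; where the high part
dominates, [psi] is at most [2 J / s], [J] being the bound on the transform of the
high part, and the weak type estimate on [psi] applies.  Summing over [s] only
geometric series appear, on the side of [u] ([sum_dyadic_le]).

The endpoint [b = q] is the Hausdorff-Young inequality, with a constant
([hausdorff_young_le]).  It is Paley's inequality for the weight
[psi = |u^|^q]: by Markov's inequality its supremum is at most the integral [X] of
[|u^|^q], and the exponents are such that Paley's inequality reads
[X <= C X^(2-p) N^p] with [N] the L^p norm of [u].  As [X] is finite (the
transform of [u] is bounded and in L^2), it can be divided out.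

For [b] in between, [|u^|^b psi^(1 - b/q)] is, after normalization, pointwise at
most the sum of the two endpoint integrands ([powR_interpolation]).

The transform of a general [f] in L^p is an L^q limit of transforms of such [u],
and the weighted inequality survives the limit ([integral_perturb_le]).  For these
integrals to behave, [u^] has to be measurable; it is continuous on the dual,
because a Radon measure lets one cut [u] down to a compact set, on which nearby
characters are uniformly close ([fourier_continuous]). *)

(** * Dyadic sums and powers *)

Lemma powRD_gt0 (R : realType) (x r s : R) :
  0 < x -> x `^ (r + s) = x `^ r * x `^ s.
Proof. by move=> x0; rewrite powRD// (gt_eqF x0) implybT. Qed.

Lemma powR2_gt1 (R : realType) (s : R) : 0 < s -> 1 < 2 `^ s.
Proof.
by move=> s0; have := @gt0_ltr_powR R s s0 1 2; rewrite powR1 !nnegrE; apply; lra.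
Qed.

(** Only the scales above [x] count, so the sum is governed by its first term,
whose scale is at least [max x r]; with that maximum in the bound, an induction on
[n] that doubles [r] goes through. *)
Lemma sum_dyadic_tail (R : realType) (s x r : R) n : 0 < s -> 0 < r ->
  \sum_(i < n) (r * 2 ^+ i) `^ (- s) * (x <= r * 2 ^+ i)%R%:R <=
  (1 - 2 `^ (- s))^-1 * Num.max x r `^ (- s).
Proof.
move=> s0 r0.
have le1 : 2 `^ (- s) < 1 :> R.
  by rewrite powRN invf_lt1 ?powR_gt0// powR2_gt1.
set D := (1 - _)^-1.
have D0 : 0 < D by rewrite invr_gt0 subr_gt0.
have DE : 1 + D * 2 `^ (- s) = D.
  by rewrite /D; field; rewrite subr_eq0 gt_eqF.
elim: n r r0 => [|n IH] r r0.
  by rewrite big_ord0 mulr_ge0 ?powR_ge0 ?ltW.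
rewrite big_ord_recl expr0 mulr1.
under eq_bigr do rewrite /= exprS mulrA.
have r20 : 0 < r * 2 by rewrite mulr_gt0.
apply: le_trans (lerD (lexx _) (IH _ r20)) _.
have [xr|rx] := leP x r; last first.
  have x0 := lt_trans r0 rx.
  rewrite mulr0 add0r ler_pM2l// !powRN.
  rewrite lef_pV2 ?posrE ?powR_gt0 ?lt_max ?x0//.
  by rewrite ge0_ler_powR ?nnegrE ?le_max ?lexx ?(ltW x0) ?(ltW s0).
rewrite mulr1 max_r; last by rewrite (le_trans xr)// ler_peMr ?ler1n ?ltW.
rewrite (powRM _ (ltW r0))// -{2}DE; by rewrite le_eqVlt; apply/orP; left; apply/eqP; ring.
Qed.

(** Here the last term governs; the next scale, [min (2 * x) (r * 2 ^+ n)],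
makes the bound inductive in [n]. *)
Lemma sum_dyadic_head (R : realType) (s x r : R) n : 0 < s -> 0 < r -> 0 < x ->
  \sum_(i < n) (r * 2 ^+ i) `^ s * (r * 2 ^+ i < x)%R%:R <=
  (2 `^ s - 1)^-1 * Num.min (2 * x) (r * 2 ^+ n) `^ s.
Proof.
move=> s0 r0 x0.
have lt1 := powR2_gt1 s0.
set E := (_ - 1)^-1.
have E0 : 0 < E by rewrite invr_gt0 subr_gt0.
have EE : E + 1 = E * 2 `^ s.
  by rewrite /E; field; rewrite subr_eq0 gt_eqF.
elim: n => [|n IH].
  by rewrite big_ord0 mulr_ge0 ?powR_ge0 ?ltW.
rewrite big_ord_recr /=.
have rn0 : 0 < r * 2 ^+ n by rewrite mulr_gt0 ?exprn_gt0.
have rS : r * 2 ^+ n.+1 = 2 * (r * 2 ^+ n) by rewrite exprS mulrCA.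
apply: le_trans (lerD IH (lexx _)) _.
have [rx|xr] := ltP (r * 2 ^+ n) x.
  rewrite mulr1 rS !min_r; [|by rewrite ler_pM2l ?ltW|lra].
  by rewrite [(2 * _) `^ _]powRM ?(ltW rn0)// mulrA -EE mulrDl mul1r.
have rnS : r * 2 ^+ n <= 2 * (r * 2 ^+ n) by lra.
have x2 : 0 <= 2 * x by lra.
rewrite mulr0 addr0 ler_pM2l// rS ge0_ler_powR ?(ltW s0)//.
- by rewrite nnegrE le_min x2 ltW.
- by rewrite nnegrE le_min x2 (le_trans _ rnS)// ltW.
- by rewrite le_min !ge_min lexx rnS orbT.
Qed.

(** With [x = G ^ q] the left-hand side is [x ^ (b / q) * Psi ^ (1 - b / q)].  If
[x <= Psi], lowering the exponent of [x] to [p / q] in favour of [Psi] increases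
it; otherwise raise that exponent to 1. *)
Lemma powR_interpolation (R : realType) (G Psi p b q : R) :
  0 <= G -> 0 < Psi -> 0 < p -> p <= b -> b <= q ->
  G `^ b * Psi `^ (1 - b / q) <= G `^ p * Psi `^ (1 - p / q) + G `^ q.
Proof.
move=> G0 P0 p0 pb bq.
have b0 : 0 < b by lra.
have q0 : 0 < q by lra.
have [->|Gn0] := eqVneq G 0.
  by rewrite !powR0 ?gt_eqF// !mul0r addr0.
have {Gn0}G0 : 0 < G by rewrite lt_neqAle eq_sym Gn0.
have [PG|GP] := leP (G `^ q) Psi.
  rewrite (le_trans (y := G `^ p * Psi `^ (1 - p / q)))//; last first.
    by rewrite lerDl powR_ge0.
  have -> : 1 - p / q = (b - p) / q + (1 - b / q) by field; lra.
  rewrite (@powRD_gt0 _ Psi ((b - p) / q))// [G `^ p * (_ * _)]mulrA ler_wpM2r ?powR_ge0//.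
  have -> : G `^ b = G `^ p * (G `^ q) `^ ((b - p) / q).
    rewrite -powRrM -powRD_gt0//.
    by congr (_ `^ _); field; lra.
  rewrite ler_wpM2l ?powR_ge0// ge0_ler_powR ?nnegrE ?powR_ge0 ?(ltW P0)//.
  by rewrite divr_ge0; lra.
rewrite (le_trans (y := G `^ q))//; last by rewrite lerDr mulr_ge0 ?powR_ge0.
have {2}-> : q = b + q * (1 - b / q) by field; lra.
rewrite (@powRD_gt0 _ _ b)//.
rewrite ler_wpM2l ?powR_ge0// powRrM ge0_ler_powR ?nnegrE ?powR_ge0 ?(ltW P0) ?(ltW GP)//.
by rewrite subr_ge0 ler_pdivrMr ?mul1r.
Qed.

(** * Integrals with a weight of weak type *)

Lemma measurable_natr_bool d (T : measurableType d) (R : realType)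
    (b : T -> bool) :
  measurable_fun setT b -> measurable_fun setT (fun x => (b x)%:R : R).
Proof.
move=> mb; have mc : measurable_fun setT (fun c : bool => c%:R : R) by [].
exact: (measurableT_comp mc mb).
Qed.

Lemma measurable_powRr d (T : measurableType d) (R : realType) (f : T -> R) r :
  measurable_fun setT f -> measurable_fun setT (fun x => f x `^ r).
Proof. by move=> mf; exact: (measurableT_comp (measurable_powR r) mf). Qed.

(** Second-order patterns keep each rule from being tried up to conversion. *)
Ltac solve_measurable := repeat (first [assumption | exact: measurable_cst |
  lazymatch goal with
  | |- measurable_fun _ (fun x => (@?f x)%:E) => apply/measurable_EFinP
  | |- measurable_fun _ (EFin \o _) => apply/measurable_EFinP
  | |- measurable_fun _ (fun x => (@?f x * @?g x)%E) => apply: emeasurable_funM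
  | |- measurable_fun _ (fun x => @?f x * @?g x) => apply: measurable_funM
  | |- measurable_fun _ (fun x => @?f x + @?g x) => apply: measurable_funD
  | |- measurable_fun _ (fun x => @?f x ^+ _) => apply: measurable_funX
  | |- measurable_fun _ (fun x => @?f x `^ _) => apply: measurable_powRr
  | |- measurable_fun _ (fun x => (nat_of_bool (@?b x))%:R) =>
    apply: measurable_natr_bool
  | |- measurable_fun _ (fun x => @?f x && @?g x) => apply: measurable_and
  | |- measurable_fun _ (fun x => @?f x <= @?g x) => apply: measurable_fun_ler
  | |- measurable_fun _ (fun x => @?f x < @?g x) => apply: measurable_fun_ltr
  end]).

Lemma ge0_integral_exhaust d (T : measurableType d) (R : realType)
    (mu : {measure set T -> \bar R}) (D : (set T)^nat) (f : T -> R) (B : \bar R) :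
  nondecreasing_seq D -> (forall n, measurable (D n)) ->
  measurable_fun setT f -> (forall x, 0 <= f x) ->
  (forall x, f x != 0 -> exists n, D n x) ->
  (forall n, (\int[mu]_(x in D n) (f x)%:E <= B)%E) ->
  (\int[mu]_x (f x)%:E <= B)%E.
Proof.
move=> ndD mD mf f0 fD fB.
have <- : (\int[mu]_(x in \bigcup_n D n) (f x)%:E = \int[mu]_x (f x)%:E)%E.
  rewrite integral_mkcond; apply: eq_integral => x _.
  rewrite patchE; case: ifPn => // /negP nx.
  have [->//|/fD[n Dn]] := eqVneq (f x) 0.
  by exfalso; apply: nx; rewrite inE; exists n.
have cv := @ge0_nondecreasing_set_cvg_integral _ _ _ D (EFin \o f) mu ndD mD.
rewrite -(cvg_lim _ (cv _ _))//.
- apply: lime_le; last exact: nearW.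
  apply: ereal_nondecreasing_is_cvgn.
  apply: ge0_nondecreasing_set_nondecreasing_integral => //.
    by move=> i; apply: measurable_funTS; solve_measurable.
  by move=> i x _; rewrite lee_fin.
- by move=> i; apply: measurable_funTS; solve_measurable.
- by move=> i x _; rewrite lee_fin.
Qed.

Lemma integral_patch_natr d (T : measurableType d) (R : realType)
    (mu : {measure set T -> \bar R}) (f : T -> R) (b : T -> bool) :
  (\int[mu]_(x in [set x | b x]) (f x)%:E =
   \int[mu]_x (f x * (b x)%:R)%:E)%E.
Proof.
rewrite integral_mkcond; apply: eq_integral => x _.
rewrite patchE; case: ifPn => [|/negP].
  by rewrite inE /= => ->; rewrite mulr1.
by rewrite inE /= => /negP/negbTE ->; rewrite mulr0.
Qed.

Lemma integral_natr d (T : measurableType d) (R : realType)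
    (mu : {measure set T -> \bar R}) (b : T -> bool) :
  measurable_fun setT b ->
  (\int[mu]_x ((b x)%:R : R)%:E = mu [set x | b x])%E.
Proof.
move=> mb.
have mB : measurable [set x | b x].
  by rewrite -[X in measurable X]setTI; exact: mb.
rewrite -[in RHS](setIT [set x | b x]) -(integral_indic _ measurableT mB).
apply: eq_integral => x _; rewrite indicE.
by have -> : (x \in [set x | b x]) = b x by apply/idP/idP; rewrite inE.
Qed.

Section weak_type_weight.
Context d (T : measurableType d) (R : realType).
Variables (mu : {measure set T -> \bar R}) (psi : T -> R) (M : R).
Hypotheses (mpsi : measurable_fun setT psi) (psi0 : forall y, 0 <= psi y).
Hypotheses (M0 : 0 <= M).
Hypothesis psiM :
  forall t : R, 0 < t -> (t%:E * mu [set y | (t <= psi y)%R] <= M%:E)%E.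

(** Peel off the top layer [v / 2 < psi <= v]: it has measure at most
[2 M / v], so it contributes at most [2 M v], and what remains is the same
integral for [v / 2]. *)
Lemma integral_sqr_level n (v : R) : 0 < v ->
  (\int[mu]_y (psi y ^+ 2 * (v / 2 ^+ n < psi y <= v)%R%:R)%:E
   <= (4 * M * v)%:E)%E.
Proof.
elim: n v => [|n IH] v v0.
  rewrite integral0_eq ?lee_fin ?mulr_ge0 ?(ltW v0)// => y _.
  by rewrite expr0 divr1 ltNge andNb mulr0.
have v20 : 0 < v / 2 by rewrite divr_gt0.
have -> : 4 * M * v = v ^+ 2 * (2 * (M / v)) + 4 * M * (v / 2).
  by field; rewrite gt_eqF.
rewrite EFinD; apply: (@le_trans _ _
   (\int[mu]_y (v ^+ 2 * (v / 2 <= psi y)%R%:R)%:E +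
    \int[mu]_y (psi y ^+ 2 * (v / 2 / 2 ^+ n < psi y <= v / 2)%R%:R)%:E)%E).
  rewrite -ge0_integralD//; last 4 first.
  - by move=> y _; rewrite lee_fin mulr_ge0// sqr_ge0.
  - by solve_measurable.
  - by move=> y _; rewrite lee_fin mulr_ge0// sqr_ge0.
  - by solve_measurable.
  apply: ge0_le_integral => //.
  - by move=> y _; rewrite lee_fin mulr_ge0// sqr_ge0.
  - by solve_measurable.
  - apply: emeasurable_funD; by solve_measurable.
  move=> y _; rewrite -EFinD lee_fin [2 ^+ n.+1]exprS invfM mulrA.
  have [pv|vp] := leP (psi y) (v / 2).
    have -> : (psi y <= v) = true by lra.
    by rewrite andbT lerDr mulr_ge0// sqr_ge0.
  rewrite andbF mulr0 addr0 (ltW vp) mulr1.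
  have [pv|_] := leP (psi y) v; last by rewrite andbF mulr0 sqr_ge0.
  rewrite andbT; case: (_ < _) => /=; last by rewrite mulr0 sqr_ge0.
  by rewrite mulr1 lerXn2r ?nnegrE// ltW.
apply: leeD; last exact: IH.
under eq_integral do rewrite EFinM.
rewrite ge0_integralZl_EFin ?sqr_ge0//; last by solve_measurable.
rewrite integral_natr; last by solve_measurable.
rewrite [leRHS]EFinM; apply: lee_wpmul2l; first by rewrite lee_fin sqr_ge0.
have := psiM v20.
rewrite -lee_pdivlMl// -EFinM => /le_trans; apply.
by rewrite lee_fin invf_div mulrAC mulrA.
Qed.

Lemma integral_sqr_sublevel (v : R) : 0 <= v ->
  (\int[mu]_y (psi y ^+ 2 * (psi y <= v)%R%:R)%:E <= (4 * M * v)%:E)%E.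
Proof.
rewrite le_eqVlt => /predU1P[<-|v0].
  rewrite integral0_eq ?mulr0// => y _; case: leP; rewrite ?mulr0// mulr1 => py0.
  have -> : psi y = 0 by apply/le_anti; rewrite py0 psi0.
  by rewrite expr0n.
apply: (@ge0_integral_exhaust _ _ _ _ (fun n => [set y | v / 2 ^+ n < psi y])).
- apply/nondecreasing_seqP => n; apply/subsetPset => y /=; apply: le_lt_trans.
  by rewrite ler_pM2l// lef_pV2 ?posrE ?exprn_gt0// exprS ler_peMl ?exprn_ge0// ler1n.
- move=> n; rewrite -[X in measurable X]setTI.
  by apply: (measurable_fun_ltr (f := cst (v / 2 ^+ n)) _ mpsi).
- by solve_measurable.
- by move=> y; rewrite mulr_ge0// sqr_ge0.
- move=> y; rewrite mulf_eq0 negb_or sqrf_eq0 => /andP[py0 _].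
  have {}py0 : 0 < psi y by rewrite lt_neqAle eq_sym py0 psi0.
  exists (Num.truncn (v / psi y)).+1 => /=.
  rewrite ltr_pdivrMr ?exprn_gt0// mulrC -ltr_pdivrMr//.
  apply: (@lt_le_trans _ _ (Num.truncn (v / psi y)).+1%:R).
    by rewrite truncnS_gt.
  by rewrite -natrX ler_nat ltnW// ltn_expl.
- move=> n; rewrite integral_patch_natr.
  apply: le_trans (integral_sqr_level n v0).
  rewrite le_eqVlt; apply/orP; left; apply/eqP; apply: eq_integral => y _.
  by congr (_%:E); rewrite -mulrA; case: (_ < _); case: (_ <= _); rewrite /= ?mulr1 ?mulr0.
Qed.

End weak_type_weight.

(** * One dyadic scale, and the sum over scales *)

Lemma exists_dyadic (R : realType) (r psi g : R) n :
  r * psi < g -> g <= r * 2 ^+ n * psi ->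
  exists i : 'I_n, r * 2 ^+ i * psi < g <= 2 * (r * 2 ^+ i) * psi.
Proof.
elim: n => [|n IH] rg gr; first by move: gr; rewrite expr0 mulr1; lra.
have [gn|ng] := leP g (r * 2 ^+ n * psi).
  by have [i ri] := IH rg gn; exists (lift ord_max i); rewrite lift_max.
by exists ord_max => /=; rewrite ng/= mulrCA -exprS.
Qed.

(** Here [h] stands for the transform of the low part and [I] for the bound on
the transform of the high part.  If [h] is the larger, [g <= 2 * h], and the
missing power of [g] is traded for [s] because [psi < g / s].  If [I] is the
larger, [psi < g / s <= 2 * I / s], and [g] is comparable to [s * psi]. *)
Lemma dyadic_split_le (R : realType) (p s psi g h I : R) :
  0 < p -> p < 2 -> 0 < s -> 0 <= psi -> 0 <= h -> 0 <= I ->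
  s * psi < g <= 2 * s * psi -> g <= h + I ->
  g `^ p * psi `^ (2 - p) <=
  4 * s `^ (- (2 - p)) * h ^+ 2 +
  (2 * s) `^ p * (psi ^+ 2 * (psi <= 2 * I / s)%R%:R).
Proof.
move=> p0 p2 s0 psi0 h0 I0 /andP[sg gs] ghI.
have g0 : 0 < g by rewrite (le_lt_trans _ sg)// mulr_ge0// ltW.
have sqE (x : R) : 0 < x -> x `^ p * x `^ (2 - p) = x ^+ 2.
  by move=> x0; rewrite -powRD_gt0// subrKC powR_mulrn// ltW.
have [Ih|hI] := leP I h.
  rewrite (le_trans (y := 4 * s `^ (- (2 - p)) * h ^+ 2))//; last first.
    by rewrite lerDl !mulr_ge0 ?powR_ge0 ?sqr_ge0.
  have psig : psi <= g / s by rewrite ler_pdivlMr// mulrC ltW.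
  rewrite (le_trans (y := g `^ p * (g / s) `^ (2 - p)))//.
    rewrite ler_wpM2l ?powR_ge0// ge0_ler_powR ?nnegrE//; first lra.
    by rewrite divr_ge0 ?(ltW g0) ?(ltW s0).
  have -> : (g / s) `^ (2 - p) = g `^ (2 - p) * s `^ (- (2 - p)).
    rewrite powRM ?(ltW g0) ?invr_ge0 ?(ltW s0)//.
    by rewrite -(powR_inv1 (ltW s0)) -powRrM mulN1r.
  rewrite [g `^ p * _]mulrA sqE// [4 * _ * _]mulrAC ler_wpM2r ?powR_ge0//.
  have -> : 4 * h ^+ 2 = (2 * h) ^+ 2 by ring.
  by rewrite lerXn2r ?nnegrE//; lra.
have -> : (psi <= 2 * I / s)%R = true.
  rewrite ler_pdivlMr// mulrC; lra.
rewrite mulr1 (le_trans (y := (2 * s) `^ p * psi ^+ 2))//; last first.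
  by rewrite lerDr !mulr_ge0 ?powR_ge0 ?sqr_ge0.
have psi_gt0 : 0 < psi.
  rewrite lt_neqAle psi0 andbT eq_sym; apply/eqP => psi0'.
  by move: gs; rewrite psi0' mulr0 leNgt g0.
rewrite -sqE// mulrA ler_wpM2r ?powR_ge0// -powRM ?mulr_ge0 ?(ltW s0)//.
by rewrite ge0_ler_powR ?nnegrE ?mulr_ge0 ?(ltW s0) ?(ltW p0) ?(ltW g0).
Qed.

Definition paley_const (R : realType) (A p : R) : R :=
  4 * (1 - 2 `^ (- (2 - p)))^-1 +
  8 * 2 `^ p * A * ((2 `^ (p - 1) - 1)^-1 * 2 `^ (p - 1)).

Lemma paley_const_gt0 (R : realType) (A p : R) :
  1 < p -> p < 2 -> 0 <= A -> 0 < paley_const A p.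
Proof.
move=> p1 p2 A0; rewrite ltr_pwDl//.
  rewrite mulr_gt0// invr_gt0 subr_gt0 powRN invf_lt1 ?powR_gt0//.
  by apply: powR2_gt1; lra.
rewrite !mulr_ge0 ?powR_ge0// invr_ge0 subr_ge0 ltW//.
by apply: powR2_gt1; lra.
Qed.

(** Both geometric series are cut at the scale [x / M], which is where the
height [M * s] of the truncation meets the value [x] of the function. *)
Lemma sum_dyadic_le (R : realType) (A M p r x : R) n :
  1 < p -> p < 2 -> 0 < r -> 0 < M -> 0 <= A -> 0 <= x ->
  \sum_(i < n) (4 * (r * 2 ^+ i) `^ (- (2 - p)) *
                  (x ^+ 2 * (x <= M * (r * 2 ^+ i))%R%:R) +
                8 * 2 `^ p * A * M * (r * 2 ^+ i) `^ (p - 1) *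
                  (x * (M * (r * 2 ^+ i) < x)%R%:R)) <=
  paley_const A p * M `^ (2 - p) * x `^ p.
Proof.
move=> p1 p2 r0 M0 A0; rewrite le_eqVlt => /predU1P[<-|x0].
  rewrite big1 ?mulr_ge0 ?powR_ge0 ?(ltW (paley_const_gt0 _ _ _))// => i _.
  by rewrite expr0n/= !mul0r !mulr0 addr0.
rewrite big_split/=.
have xM0 : 0 < x / M by rewrite divr_gt0.
have tl := @sum_dyadic_tail _ (2 - p) (x / M) r n _ r0.
have hd := @sum_dyadic_head _ (p - 1) (x / M) r n _ r0 xM0.
rewrite /paley_const [(_ + _) * M `^ _]mulrDl [(_ + _) * x `^ _]mulrDl.
apply: lerD.
  apply: (@le_trans _ _ (4 * x ^+ 2 *
    ((1 - 2 `^ (- (2 - p)))^-1 * (x / M) `^ (- (2 - p))))).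
    apply: le_trans (ler_wpM2l _ (le_trans (tl _) _)); last first.
    - rewrite ler_wpM2l//.
        rewrite invr_ge0 subr_ge0 powRN invf_le1 ?powR_gt0// ltW//.
        by apply: powR2_gt1; lra.
      rewrite !powRN lef_pV2 ?posrE ?powR_gt0 ?lt_max ?xM0//.
      by rewrite ge0_ler_powR ?nnegrE ?le_max ?lexx ?(ltW xM0)//; lra.
    - lra.
    - by rewrite mulr_ge0// sqr_ge0.
    rewrite mulr_sumr le_eqVlt; apply/orP; left; apply/eqP; apply: eq_bigr => i _.
    by rewrite ler_pdivrMr// [r * 2 ^+ i * M]mulrC; ring.
  rewrite le_eqVlt; apply/orP; left; apply/eqP.
  have -> : x `^ p = x ^+ 2 * x `^ (- (2 - p)).
    by rewrite -powR_mulrn ?ltW// -powRD_gt0//; congr (_ `^ _); ring.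
  rewrite powRM ?invr_ge0 ?(ltW M0) ?(ltW x0)//.
  rewrite -[M^-1](powR_inv1 (ltW M0)) -powRrM mulN1r opprK; ring.
apply: (@le_trans _ _ (8 * 2 `^ p * A * M * x *
  ((2 `^ (p - 1) - 1)^-1 * (2 * (x / M)) `^ (p - 1)))).
  apply: le_trans (ler_wpM2l _ (le_trans (hd _) _)); last first.
  - rewrite ler_wpM2l//.
      by rewrite invr_ge0 subr_ge0 ltW//; apply: powR2_gt1; lra.
    have y0 : 0 <= 2 * (x / M) by rewrite mulr_ge0 ?(ltW xM0).
    have rn0 : 0 <= r * 2 ^+ n by rewrite mulr_ge0 ?exprn_ge0 ?(ltW r0).
    rewrite ge0_ler_powR ?nnegrE ?le_min ?y0 ?rn0//; first lra.
    by rewrite ge_min lexx.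
  - lra.
  - by rewrite !mulr_ge0 ?powR_ge0 ?(ltW M0) ?(ltW x0).
  rewrite mulr_sumr le_eqVlt; apply/orP; left; apply/eqP; apply: eq_bigr => i _.
  by rewrite ltr_pdivlMr// [r * 2 ^+ i * M]mulrC; ring.
rewrite le_eqVlt; apply/orP; left; apply/eqP.
have -> : x `^ p = x * x `^ (p - 1) by rewrite mulr_powRB1 ?(ltW x0)//; lra.
have -> : M `^ (2 - p) = M * M `^ (- (p - 1)).
  rewrite -[X in _ = X * _](powRr1 (ltW M0)) -powRD_gt0//; congr (_ `^ _); ring.
rewrite powRM ?mulr_ge0 ?invr_ge0 ?(ltW M0) ?(ltW x0)//.
rewrite powRM ?invr_ge0 ?(ltW M0) ?(ltW x0)//.
rewrite -[M^-1](powR_inv1 (ltW M0)) -powRrM mulN1r; ring.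
Qed.

(** * Paley and Hausdorff-Young inequalities *)

(** The hypotheses keep what the argument uses of the Fourier transform: [u] and
[g] are the absolute values of a function and of its transform, [h c] that of the
transform of the function cut below height [c], and [J c] a bound for the
transform of what lies above [c]. *)
Section paley.
Context (R : realType) dX (X : measurableType dX) dY (Y : measurableType dY).
Variables (mu : {measure set X -> \bar R}) (nu : {measure set Y -> \bar R}).
Variables (A p : R) (u : X -> R) (g : Y -> R) (h : R -> Y -> R) (J : R -> R).
Hypotheses (A0 : 0 <= A) (p1 : 1 < p) (p2 : p < 2).
Hypotheses (mmu : measurable_fun setT u) (u0 : forall x, 0 <= u x).
Hypotheses (mg : measurable_fun setT g) (g0 : forall y, 0 <= g y).
Hypotheses (mh : forall c, measurable_fun setT (h c)).
Hypotheses (h0 : forall c y, 0 <= h c y) (J0 : forall c, 0 <= J c).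
Hypothesis ghJ : forall (c : R) y, 0 < c -> g y <= h c y + J c.
Hypothesis hL2 : forall c : R, 0 < c ->
  (\int[nu]_y (h c y ^+ 2)%:E <=
   \int[mu]_x (u x ^+ 2 * (u x <= c)%R%:R)%:E)%E.
Hypothesis JL1 : forall c : R, 0 < c ->
  ((J c)%:E <= A%:E * \int[mu]_x (u x * (c < u x)%R%:R)%:E)%E.

Section weight.
Variables (psi : Y -> R) (M : R).
Hypotheses (mpsi : measurable_fun setT psi) (psi0 : forall y, 0 <= psi y).
Hypotheses (M0 : 0 < M).
Hypothesis psiM :
  forall t : R, 0 < t -> (t%:E * nu [set y | (t <= psi y)%R] <= M%:E)%E.

(** Plancherel for the low part; for the high part, the weak type bound on
[psi] at the level [v = 2 * J (M * s) / s]. *)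
Lemma integral_dyadic_le (s : R) : 0 < s ->
  (\int[nu]_y (4 * s `^ (- (2 - p)) * h (M * s) y ^+ 2 +
     (2 * s) `^ p * (psi y ^+ 2 * (psi y <= 2 * J (M * s) / s)%R%:R))%:E <=
   \int[mu]_x (4 * s `^ (- (2 - p)) * (u x ^+ 2 * (u x <= M * s)%R%:R) +
     8 * 2 `^ p * A * M * s `^ (p - 1) * (u x * (M * s < u x)%R%:R))%:E)%E.
Proof.
move=> s0; have Ms0 : 0 < M * s by rewrite mulr_gt0.
have c1 : 0 <= 4 * s `^ (- (2 - p)) by rewrite mulr_ge0 ?powR_ge0.
have c2 : 0 <= (2 * s) `^ p by rewrite powR_ge0.
have c3 : 0 <= 8 * 2 `^ p * A * M * s `^ (p - 1).
  by rewrite !mulr_ge0 ?powR_ge0 ?(ltW M0).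
have sq0 (x : R) : 0 <= x ^+ 2 by rewrite sqr_ge0.
under eq_integral do rewrite EFinD.
under [leRHS]eq_integral do rewrite EFinD.
rewrite ge0_integralD//; try solve [by solve_measurable |
  by move=> y _; rewrite lee_fin ?mulr_ge0 ?powR_ge0 ?(ltW M0)].
rewrite ge0_integralD//; try solve [by solve_measurable |
  by move=> y _; rewrite lee_fin ?mulr_ge0 ?powR_ge0 ?(ltW M0)].
under eq_integral do rewrite EFinM.
under [X in (_ + X <= _)%E]eq_integral do rewrite EFinM.
under [X in (_ <= X + _)%E]eq_integral do rewrite EFinM.
under [X in (_ <= _ + X)%E]eq_integral do rewrite EFinM.
rewrite !ge0_integralZl_EFin//; try solve [by solve_measurable |
  by move=> y _; rewrite lee_fin ?mulr_ge0 ?powR_ge0 ?(ltW M0)].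
apply: leeD; first by rewrite lee_wpmul2l// hL2.
have v0 : 0 <= 2 * J (M * s) / s by rewrite !mulr_ge0 ?invr_ge0 ?(ltW s0).
apply: le_trans (lee_wpmul2l _ (integral_sqr_sublevel mpsi psi0 (ltW M0) psiM v0)) _.
  by rewrite lee_fin.
have c4 : 0 <= 8 * 2 `^ p * M * s `^ (p - 1).
  by rewrite !mulr_ge0 ?powR_ge0 ?(ltW M0).
rewrite -EFinM.
have -> : (2 * s) `^ p * (4 * M * (2 * J (M * s) / s)) =
    8 * 2 `^ p * M * s `^ (p - 1) * J (M * s).
  have p_gt0 : 0 < p := lt_trans ltr01 p1.
  rewrite powRM ?(ltW s0)// -(mulr_powRB1 (ltW s0) p_gt0).
  by field; rewrite gt_eqF.
have -> : 8 * 2 `^ p * A * M * s `^ (p - 1) =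
    8 * 2 `^ p * M * s `^ (p - 1) * A by ring.
by rewrite [leLHS]EFinM [in leRHS]EFinM -muleA lee_wpmul2l// JL1.
Qed.

Lemma paley_level (r : R) n : 0 < r ->
  (\int[nu]_(y in [set y | (r * psi y < g y <= r * 2 ^+ n * psi y)%R])
     (g y `^ p * psi y `^ (2 - p))%:E <=
   (paley_const A p * M `^ (2 - p))%:E * \int[mu]_x (u x `^ p)%:E)%E.
Proof.
move=> r0; have rn0 i : 0 < r * 2 ^+ i by rewrite mulr_gt0 ?exprn_gt0.
have sq0 (x : R) : 0 <= x ^+ 2 by rewrite sqr_ge0.
rewrite integral_patch_natr.
pose F (i : 'I_n) y : R :=
  4 * (r * 2 ^+ i) `^ (- (2 - p)) * h (M * (r * 2 ^+ i)) y ^+ 2 +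
  (2 * (r * 2 ^+ i)) `^ p *
    (psi y ^+ 2 * (psi y <= 2 * J (M * (r * 2 ^+ i)) / (r * 2 ^+ i))%R%:R).
pose E (i : 'I_n) x : R :=
  4 * (r * 2 ^+ i) `^ (- (2 - p)) * (u x ^+ 2 * (u x <= M * (r * 2 ^+ i))%R%:R) +
  8 * 2 `^ p * A * M * (r * 2 ^+ i) `^ (p - 1) *
    (u x * (M * (r * 2 ^+ i) < u x)%R%:R).
have F0 i y : 0 <= F i y by rewrite addr_ge0// !mulr_ge0 ?powR_ge0.
have E0 i x : 0 <= E i x by rewrite addr_ge0// !mulr_ge0 ?powR_ge0 ?(ltW M0).
have mF i : measurable_fun setT (F i) by rewrite /F; solve_measurable.
have mE i : measurable_fun setT (E i) by rewrite /E; solve_measurable.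
apply: (@le_trans _ _ (\int[nu]_y (\sum_(i < n) (F i y)%:E))%E).
  apply: ge0_le_integral => //.
  - by move=> y _; rewrite lee_fin !mulr_ge0 ?powR_ge0.
  - by solve_measurable.
  - by apply: emeasurable_sum => i; solve_measurable.
  move=> y _; rewrite sumEFin lee_fin.
  case: andP => [[rg gr]|_]; last by rewrite mulr0 sumr_ge0.
  rewrite mulr1; have [i /andP[gi1 gi2]] := exists_dyadic rg gr.
  rewrite (bigD1 i)//= (le_trans (y := F i y))//; last first.
    by rewrite lerDl sumr_ge0.
  apply: (@dyadic_split_le _ _ _ _ _ _ (J (M * (r * 2 ^+ i)))) => //.
  - exact: lt_trans ltr01 p1.
  - by rewrite gi1.
  - by rewrite ghJ// mulr_gt0.
rewrite ge0_integral_sum//; last 2 first.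
- by move=> i; apply/measurable_EFinP; exact: mF.
- by move=> i y _; rewrite lee_fin.
apply: (@le_trans _ _ (\sum_(i < n) \int[mu]_x (E i x)%:E)%E).
  by apply: lee_sum => i _; exact: integral_dyadic_le.
have c0 : 0 <= paley_const A p * M `^ (2 - p).
  by rewrite mulr_ge0 ?powR_ge0// ltW// paley_const_gt0.
rewrite -ge0_integral_sum//; last 2 first.
- by move=> i; apply/measurable_EFinP; exact: mE.
- by move=> i y _; rewrite lee_fin.
rewrite -ge0_integralZl_EFin//; last 2 first.
- by move=> x _; rewrite lee_fin powR_ge0.
- by solve_measurable.
apply: ge0_le_integral => //.
- by move=> x _; rewrite sumEFin lee_fin sumr_ge0.
- by apply: emeasurable_sum => i; apply/measurable_EFinP; exact: mE.
- by solve_measurable.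
by move=> x _; rewrite sumEFin -EFinM lee_fin; exact: sum_dyadic_le.
Qed.

(** As the constant of [paley_level] depends neither on the first scale nor on
the number of scales, the scales from [2 ^- n] to [2 ^+ n] exhaust the set where
the integrand does not vanish. *)
Lemma paley_le :
  (\int[nu]_y (g y `^ p * psi y `^ (2 - p))%:E <=
   (paley_const A p * M `^ (2 - p))%:E * \int[mu]_x (u x `^ p)%:E)%E.
Proof.
have pow0 n : 0 < 2 ^- n :> R by rewrite invr_gt0 exprn_gt0.
apply: (@ge0_integral_exhaust _ _ _ _
  (fun n => [set y | (2 ^- n * psi y < g y <= 2 ^- n * 2 ^+ (2 * n) * psi y)%R])).
- apply/nondecreasing_seqP => n; apply/subsetPset => y /= /andP[gl gr].
  have e k : 2 ^- k * 2 ^+ (2 * k) = 2 ^+ k :> R.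
    by rewrite mul2n -addnn exprD mulKf// expf_neq0.
  move: gr; rewrite !e => gr; apply/andP; split.
    apply: le_lt_trans gl; rewrite ler_wpM2r// lef_pV2 ?posrE ?exprn_gt0//.
    by rewrite exprS ler_peMl ?exprn_ge0// ler1n.
  apply: (le_trans gr); rewrite ler_wpM2r//.
  by rewrite exprS ler_peMl ?exprn_ge0// ler1n.
- move=> n; rewrite -[X in measurable X]setTI.
  have mb : measurable_fun setT
      (fun y => (2 ^- n * psi y < g y <= 2 ^- n * 2 ^+ (2 * n) * psi y)%R).
    by solve_measurable.
  exact: mb.
- by solve_measurable.
- by move=> y; rewrite mulr_ge0 ?powR_ge0.
- move=> y; rewrite mulf_eq0 negb_or => /andP[gn0 pn0].
  have gy : 0 < g y.
    rewrite lt_neqAle g0 andbT eq_sym; apply: contra gn0 => /eqP ->.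
    by rewrite powR0// gt_eqF//; move: p1 p2; lra.
  have py : 0 < psi y.
    rewrite lt_neqAle psi0 andbT eq_sym; apply: contra pn0 => /eqP ->.
    by rewrite powR0// gt_eqF//; move: p1 p2; lra.
  have e k : 2 ^- k * 2 ^+ (2 * k) = 2 ^+ k :> R.
    by rewrite mul2n -addnn exprD mulKf// expf_neq0.
  pose k := (Num.truncn (psi y / g y + g y / psi y)).+1.
  have kb : psi y / g y + g y / psi y < 2 ^+ k.
    rewrite (lt_trans (truncnS_gt _))// -natrX ltr_nat.
    exact: ltn_expl.
  have [gp pg] : 0 < g y / psi y /\ 0 < psi y / g y by rewrite !divr_gt0.
  exists k => /=; rewrite e; apply/andP; split.
    rewrite mulrC ltr_pdivrMr ?exprn_gt0// mulrC -ltr_pdivrMr//; lra.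
  rewrite -ler_pdivrMr//; lra.
- by move=> n; exact: paley_level.
Qed.

End weight.

(** Paley's inequality for the weight [psi = g ^ q], [q = p / (p - 1)]: the
identity [p + q * (2 - p) = q] turns its left-hand side into the integral of
[g ^ q] itself. *)
Lemma hausdorff_young_le (N : R) : 0 < N ->
  (\int[nu]_y (g y `^ (p / (p - 1)))%:E < +oo)%E ->
  (\int[mu]_x (u x `^ p)%:E <= (N `^ p)%:E)%E ->
  (\int[nu]_y (g y `^ (p / (p - 1)))%:E <=
   (paley_const A p `^ (p - 1)^-1 * N `^ (p / (p - 1)))%:E)%E.
Proof.
move=> N0; set Q := (\int[nu]_y _)%E => Qoo uN.
have Q0 : (0 <= Q)%E by apply: integral_ge0 => y _; rewrite lee_fin powR_ge0.
have K0 := paley_const_gt0 p1 p2 A0.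
have [QE|Qn0] := eqVneq Q 0%E.
  by rewrite QE lee_fin mulr_ge0 ?powR_ge0.
have Qfin : Q \is a fin_num by rewrite ge0_fin_numE.
pose M := fine Q; have QM : Q = M%:E by rewrite fineK.
have M0 : 0 < M by rewrite -lte_fin -QM lt_neqAle eq_sym Qn0.
have mgq : measurable_fun setT (fun y => g y `^ (p / (p - 1))) by solve_measurable.
have weak (t : R) : 0 < t ->
    (t%:E * nu [set y | (t <= g y `^ (p / (p - 1)))%R] <= M%:E)%E.
  move=> t0; rewrite -QM -integral_natr; last by solve_measurable.
  rewrite -ge0_integralZl_EFin ?(ltW t0)//; last by solve_measurable.
  apply: ge0_le_integral => //.
  - by move=> y _; rewrite -EFinM lee_fin mulr_ge0// ltW.
  - by solve_measurable.
  - by solve_measurable.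
  move=> y _; rewrite -EFinM lee_fin.
  have [ty|ty] := leP t (g y `^ _); rewrite ?mulr1 ?mulr0//.
  exact: powR_ge0.
have := paley_le mgq (fun y => powR_ge0 _ _) M0 weak.
have -> : (\int[nu]_y (g y `^ p * (g y `^ (p / (p - 1))) `^ (2 - p))%:E = M%:E)%E.
  rewrite -QM; apply: eq_integral => y _; congr (_%:E).
  have [->|gn0] := eqVneq (g y) 0.
    have [q0 p0] : 0 < p / (p - 1) /\ 0 < p by rewrite divr_gt0; move: p1; lra.
    by rewrite (powR0 (lt0r_neq0 p0)) (powR0 (lt0r_neq0 q0)) mul0r.
  rewrite -powRrM -powRD ?gn0 ?implybT//; congr (_ `^ _); field; move: p1; lra.
move=> /le_trans/(_ (lee_wpmul2l _ uN)); rewrite -EFinM !lee_fin QM lee_fin.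
have KM0 : 0 <= paley_const A p * M `^ (2 - p).
  by rewrite mulr_ge0 ?powR_ge0// ltW.
move=> /(_ KM0) MK.
have {}MK : M `^ (p - 1) <= paley_const A p * N `^ p.
  have e : M = M `^ (p - 1) * M `^ (2 - p).
    by rewrite -powRD_gt0// -[LHS](powRr1 (ltW M0)); congr (_ `^ _); ring.
  rewrite -(@ler_pM2r _ (M `^ (2 - p))) ?powR_gt0// -e (le_trans MK)//.
  by rewrite mulrAC.
have -> : M = (M `^ (p - 1)) `^ (p - 1)^-1.
  by rewrite -powRrM mulfV ?powRr1 ?(ltW M0)//; move: p1; lra.
have -> : N `^ (p / (p - 1)) = (N `^ p) `^ (p - 1)^-1 by rewrite -powRrM.
rewrite -powRM ?powR_ge0 ?(ltW K0)//.
rewrite ge0_ler_powR ?nnegrE ?powR_ge0 ?mulr_ge0 ?powR_ge0 ?(ltW K0)//.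
by rewrite invr_ge0; move: p1; lra.
Qed.

End paley.

(** Apply [powR_interpolation] to [g / N] and [psi / M]; this normalization gives
the two endpoint integrals the same size. *)
Lemma interpolation_le (R : realType) d (Y : measurableType d)
    (nu : {measure set Y -> \bar R}) (g psi : Y -> R) (p b q K1 K2 M N : R) :
  measurable_fun setT g -> (forall y, 0 <= g y) ->
  measurable_fun setT psi -> (forall y, 0 < psi y) ->
  0 < M -> 0 < N -> 0 < p -> p <= b -> b <= q ->
  (\int[nu]_y (g y `^ p * psi y `^ (1 - p / q))%:E <=
   (K1 * M `^ (1 - p / q) * N `^ p)%:E)%E ->
  (\int[nu]_y (g y `^ q)%:E <= (K2 * N `^ q)%:E)%E ->
  (\int[nu]_y (g y `^ b * psi y `^ (1 - b / q))%:E <=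
   ((K1 + K2) * M `^ (1 - b / q) * N `^ b)%:E)%E.
Proof.
move=> mg g0 mpsi psi0 M0 N0 p0 pb bq H1 H2.
(* The constants by which the two endpoint integrands are multiplied once the
   normalization by [N] and [M] is undone. *)
pose c1 := N `^ b * M `^ (1 - b / q) / (M `^ (1 - p / q) * N `^ p).
pose c2 := N `^ b * M `^ (1 - b / q) / N `^ q.
have c10 : 0 <= c1 by rewrite !mulr_ge0 ?invr_ge0 ?mulr_ge0 ?powR_ge0.
have c20 : 0 <= c2 by rewrite !mulr_ge0 ?invr_ge0 ?mulr_ge0 ?powR_ge0.
have -> : (K1 + K2) * M `^ (1 - b / q) * N `^ b =
    c1 * (K1 * M `^ (1 - p / q) * N `^ p) + c2 * (K2 * N `^ q).
  by rewrite /c1 /c2; field; rewrite !gt_eqF ?powR_gt0.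
rewrite EFinD !(EFinM c1) !(EFinM c2).
apply: (le_trans _ (leeD (lee_wpmul2l _ H1) (lee_wpmul2l _ H2))); last 2 first.
- exact: c10.
- exact: c20.
rewrite -!ge0_integralZl_EFin//; try solve [by solve_measurable |
  by move=> y _; rewrite lee_fin ?mulr_ge0 ?powR_ge0].
rewrite -ge0_integralD//; try solve [
  by move=> y _; rewrite -EFinM lee_fin mulr_ge0// ?mulr_ge0 ?powR_ge0 |
  by solve_measurable].
apply: ge0_le_integral => //.
- by move=> y _; rewrite lee_fin ?mulr_ge0 ?powR_ge0.
- by solve_measurable.
- by apply: emeasurable_funD; solve_measurable.
move=> y _; rewrite -!EFinM -EFinD lee_fin.
have gN : 0 <= g y / N by rewrite divr_ge0// ltW.
have pM : 0 < psi y / M by rewrite divr_gt0.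
have := powR_interpolation gN pM p0 pb bq.
have powRV (a c : R) r : 0 <= a -> 0 < c -> (a / c) `^ r = a `^ r / c `^ r.
  move=> a0 cp; rewrite powRM ?invr_ge0 ?(ltW cp)//.
  by rewrite -(powR_inv1 (ltW cp)) powRAC powR_inv1// powR_ge0.
rewrite !powRV ?(ltW (psi0 _))// => H.
rewrite /c1 /c2.
have NM : 0 < N `^ b * M `^ (1 - b / q) by rewrite mulr_gt0 ?powR_gt0.
have {}H := ler_wpM2l (ltW NM) H.
apply: le_trans (le_trans H _); rewrite le_eqVlt; apply/orP; left; apply/eqP.
  by field; rewrite !gt_eqF ?powR_gt0.
by field; rewrite !gt_eqF ?powR_gt0.
Qed.

(** * Stability of weighted bounds under L^q approximation *)

(** On the set [w <= j], [g >= 1/j], either [e <= g / 2], and then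
[g <= 2 * g1]; or [e] is at least [1 / (2 * j)], and then [g ^ b * w] is at most a
multiple [C] of [e ^ q], depending on [j] only.  Letting the error tend to 0
first, and then [j] to infinity, costs only the factor [2 ^ b]. *)
Lemma integral_perturb_le (R : realType) d (Y : measurableType d)
    (nu : {measure set Y -> \bar R}) (g w : Y -> R) (b q B : R) :
  measurable_fun setT g -> (forall y, 0 <= g y) ->
  measurable_fun setT w -> (forall y, 0 <= w y) -> 0 < b -> b <= q ->
  (forall eps : R, 0 < eps -> exists g1 e : Y -> R,
    [/\ measurable_fun setT g1 /\ measurable_fun setT e,
        forall y, 0 <= g1 y /\ 0 <= e y, forall y, g y <= g1 y + e y,
        (\int[nu]_y (g1 y `^ b * w y)%:E <= B%:E)%E &
        (\int[nu]_y (e y `^ q)%:E <= eps%:E)%E]) ->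
  (\int[nu]_y (g y `^ b * w y)%:E <= (2 `^ b * B)%:E)%E.
Proof.
move=> mg g0 mw w0 b0 bq approx.
apply: (@ge0_integral_exhaust _ _ _ _
  (fun n => [set y | (w y <= n.+1%:R) && (n.+1%:R^-1 <= g y)])).
- apply/nondecreasing_seqP => n; apply/subsetPset => y /= /andP[wn gn].
  rewrite (le_trans wn) ?ler_nat//= (le_trans _ gn)//.
  by rewrite lef_pV2 ?posrE// ler_nat.
- move=> n; rewrite -[X in measurable X]setTI.
  have mb : measurable_fun setT (fun y => (w y <= n.+1%:R) && (n.+1%:R^-1 <= g y)).
    by solve_measurable.
  exact: mb.
- by solve_measurable.
- by move=> y; rewrite mulr_ge0 ?powR_ge0.
- move=> y; rewrite mulf_eq0 negb_or => /andP[gn0 _].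
  have gy : 0 < g y.
    rewrite lt_neqAle g0 andbT eq_sym; apply: contra gn0 => /eqP ->.
    by rewrite powR0// gt_eqF.
  exists (Num.truncn (w y + (g y)^-1)) => /=.
  have := truncnS_gt (w y + (g y)^-1).
  have g10 : 0 <= (g y)^-1 by rewrite invr_ge0.
  have wy := w0 y.
  move=> H; apply/andP; split; first by lra.
  rewrite -[leRHS]invrK lef_pV2 ?posrE ?invr_gt0 ?ltr0Sn//. by lra.
move=> n; rewrite integral_patch_natr; set j : R := n.+1%:R.
have j0 : 0 < j by rewrite ltr0n.
pose C := 2 `^ b * j * (2 * j) `^ (q - b).
have C0 : 0 < C by rewrite !mulr_gt0 ?powR_gt0 ?mulr_gt0.
apply/lee_addgt0Pr => eps eps0.
have [g1 [e [[mg1 me] ge0 gge B1 e1]]] := approx _ (divr_gt0 eps0 C0).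
have g10 y : 0 <= g1 y by case: (ge0 y).
have e0 y : 0 <= e y by case: (ge0 y).
have b20 : 0 <= 2 `^ b :> R by rewrite powR_ge0.
apply: (@le_trans _ _ ((2 `^ b)%:E * \int[nu]_y (g1 y `^ b * w y)%:E +
                       C%:E * \int[nu]_y (e y `^ q)%:E)%E); last first.
  rewrite (EFinM (2 `^ b)); apply: leeD; first exact: lee_wpmul2l.
  have C0E : (0 <= C%:E)%E by rewrite lee_fin ltW.
  apply: (le_trans (lee_wpmul2l C0E e1)).
  by rewrite -EFinM lee_fin mulrC divfK ?gt_eqF.
rewrite -!ge0_integralZl_EFin ?(ltW C0)//; try solve [by solve_measurable |
  by move=> y _; rewrite lee_fin ?mulr_ge0 ?powR_ge0].
rewrite -ge0_integralD//; try solve [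
  by move=> y _; rewrite -EFinM lee_fin mulr_ge0 ?(ltW C0)// ?mulr_ge0 ?powR_ge0 |
  by solve_measurable].
apply: ge0_le_integral => //.
- by move=> y _; rewrite lee_fin !mulr_ge0 ?powR_ge0.
- by solve_measurable.
- by apply: emeasurable_funD; solve_measurable.
move=> y _; rewrite -!EFinM -EFinD lee_fin.
case: andP => [[wj jg]|_]; last first.
  by rewrite mulr0 addr_ge0 // !mulr_ge0 ?powR_ge0 ?(ltW j0).
rewrite mulr1; have [eg|ge] := leP (e y) (g y / 2).
  rewrite (le_trans (y := 2 `^ b * (g1 y `^ b * w y)))//; last first.
    by rewrite lerDl mulr_ge0 ?powR_ge0// ltW.
  rewrite mulrA -powRM// ler_wpM2r// ge0_ler_powR ?nnegrE ?(ltW b0) ?mulr_ge0//.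
  by have := gge y; lra.
rewrite (le_trans (y := C * e y `^ q))//; last first.
  by rewrite lerDr !mulr_ge0 ?powR_ge0.
have ey : 0 < e y by rewrite (le_lt_trans _ ge)// divr_ge0.
have -> : C * e y `^ q = (2 * e y) `^ b * ((2 * j * e y) `^ (q - b)) * j.
  rewrite powRM// [(2 * j * e y) `^ _]powRM ?mulr_ge0 ?(ltW j0)//.
  have -> : e y `^ q = e y `^ b * e y `^ (q - b).
    by rewrite -powRD_gt0//; congr (_ `^ _); ring.
  by rewrite /C; ring.
apply: ler_pM => //; first exact: powR_ge0.
rewrite -[leLHS]mulr1; apply: ler_pM => //; first exact: powR_ge0.
  by rewrite ge0_ler_powR ?nnegrE ?(ltW b0) ?mulr_ge0//; lra.
apply: (@le_trans _ _ (1 `^ (q - b))); first by rewrite powR1.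
rewrite ge0_ler_powR ?nnegrE ?subr_ge0 ?mulr_ge0 ?(ltW j0)//.
have -> : 2 * j * e y = j * (2 * e y) by ring.
apply: (@le_trans _ _ (j * g y)).
  by rewrite mulrC -ler_pdivrMr// mul1r.
by rewrite ler_pM2l//; lra.
Qed.

(** * Complex-valued functions *)

Lemma continuous_borel_measurable (R : realType) (T : ptopologicalType)
    (f : T -> R) : continuous f -> measurable_fun setT (f : borel T -> R).
Proof.
move=> /continuousP cf; apply: (measurability _ (RGenOpens.measurableE R)).
move=> _ [_ [a [b ->] <-]]; rewrite setTI; apply: sub_sigma_algebra.
exact/cf/interval_open.
Qed.

Section complex_norm.
Context (R : realType).
Implicit Types z w : R[i].

Lemma normc_ge0 z : 0 <= normc z. Proof. by case: z => a b; exact: sqrtr_ge0. Qed.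

Lemma ler_normc_Re z : `|complex.Re z| <= normc z.
Proof. by case: z => a b /=; rewrite -sqrtr_sqr ler_wsqrtr// lerDl sqr_ge0. Qed.

Lemma ler_normc_Im z : `|complex.Im z| <= normc z.
Proof. by case: z => a b /=; rewrite -sqrtr_sqr ler_wsqrtr// lerDr sqr_ge0. Qed.

Lemma ler_normc_ReIm z : normc z <= `|complex.Re z| + `|complex.Im z|.
Proof.
case: z => a b /=; rewrite -[leRHS]ger0_norm ?addr_ge0//.
rewrite -(sqrtr_sqr (`|a| + `|b|)) ler_wsqrtr//.
rewrite -(real_normK (num_real a)) -(real_normK (num_real b)) sqrrD.
by rewrite -addrA lerD2l lerDr mulrn_wge0// mulr_ge0.
Qed.

Lemma normcJ z : normc (z^*)%C = normc z.
Proof. by case: z => a b /=; rewrite sqrrN. Qed.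

Lemma ler_normcB z w : `|normc z - normc w| <= normc (z - w).
Proof.
have h (x y : R[i]) : normc x - normc y <= normc (x - y).
  by rewrite lerBlDr (le_trans _ (le_normcD _ _))// subrK.
by rewrite ler_norml h andbT lerNl opprB (le_trans (h _ _))// -opprB normcN.
Qed.

End complex_norm.

Section complex_measurable.
Context d (T : measurableType d) (R : realType).
Implicit Types f g : T -> R[i].

Lemma measurable_normc f : cmeasurable f -> measurable_fun setT (@normc R \o f).
Proof.
move=> [mr mi].
have -> : @normc R \o f =
    (fun x => Num.sqrt (complex.Re (f x) ^+ 2 + complex.Im (f x) ^+ 2)).
  by apply/funext => x /=; case: (f x).
have ms : measurable_fun setT (Num.sqrt : R -> R).
  by apply: continuous_measurable_fun; exact: sqrt_continuous.
apply: (measurableT_comp ms); solve_measurable.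
Qed.

Lemma cmeasurableD f g :
  cmeasurable f -> cmeasurable g -> cmeasurable (fun x => f x + g x).
Proof.
move=> [mfr mfi] [mgr mgi]; split.
  rewrite (_ : (fun x => _) =
      (fun x => complex.Re (f x) + complex.Re (g x))); first by solve_measurable.
  by apply/funext => x; case: (f x) => a b; case: (g x).
rewrite (_ : (fun x => _) =
    (fun x => complex.Im (f x) + complex.Im (g x))); first by solve_measurable.
by apply/funext => x; case: (f x) => a b; case: (g x).
Qed.

Lemma cmeasurableN f : cmeasurable f -> cmeasurable (fun x => - f x).
Proof.
move=> [mfr mfi]; split.
  rewrite (_ : (fun x => _) = (fun x => - complex.Re (f x))).
    exact: measurableT_comp.
  by apply/funext => x; case: (f x).
rewrite (_ : (fun x => _) = (fun x => - complex.Im (f x))).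
  exact: measurableT_comp.
by apply/funext => x; case: (f x).
Qed.

Lemma cmeasurableM f g :
  cmeasurable f -> cmeasurable g -> cmeasurable (fun x => f x * g x).
Proof.
move=> [mfr mfi] [mgr mgi]; split.
  rewrite (_ : (fun x => _) = (fun x => complex.Re (f x) * complex.Re (g x) +
    - (complex.Im (f x) * complex.Im (g x)))); last first.
    by apply/funext => x; case: (f x) => a b; case: (g x).
  solve_measurable.
  by apply: measurableT_comp => //; solve_measurable.
rewrite (_ : (fun x => _) = (fun x => complex.Re (f x) * complex.Im (g x) +
  complex.Im (f x) * complex.Re (g x))); last first.
  by apply/funext => x; case: (f x) => a b; case: (g x).
by solve_measurable.
Qed.

Lemma cmeasurableJ f : cmeasurable f -> cmeasurable (fun x => (f x)^*%C).
Proof.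
move=> [mfr mfi]; split.
  by rewrite (_ : (fun x => _) = (fun x => complex.Re (f x)))//;
     apply/funext => x; case: (f x).
rewrite (_ : (fun x => _) = (fun x => - complex.Im (f x))).
  exact: measurableT_comp.
by apply/funext => x; case: (f x).
Qed.

Lemma cmeasurable_real (f : T -> R) :
  measurable_fun setT f -> cmeasurable (fun x => (f x)%:C%C).
Proof. by move=> mf; split => //=; exact: measurable_cst. Qed.

Variable m : {measure set T -> \bar R}.

Lemma integrable_ReIm f : cmeasurable f ->
  (\int[m]_x (normc (f x))%:E < +oo)%E ->
  m.-integrable setT (fun x => (complex.Re (f x))%:E) /\
  m.-integrable setT (fun x => (complex.Im (f x))%:E).
Proof.
move=> mf foo; have mn := measurable_normc mf; case: (mf) => mr mi.
split; apply/integrableP; split; try by solve_measurable.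
  apply: le_lt_trans foo; apply: ge0_le_integral => //.
  - by apply: measurableT_comp => //; solve_measurable.
  - by solve_measurable.
  - by move=> x _; rewrite lee_fin ler_normc_Re.
apply: le_lt_trans foo; apply: ge0_le_integral => //.
- by apply: measurableT_comp => //; solve_measurable.
- by solve_measurable.
- by move=> x _; rewrite lee_fin ler_normc_Im.
Qed.

(** The factor 2 comes from bounding real and imaginary parts separately; it only
affects constants. *)
Lemma normc_cintegral_le f : cmeasurable f ->
  ((normc (cintegral m f))%:E <= 2%:E * \int[m]_x (normc (f x))%:E)%E.
Proof.
move=> mf; have mn := measurable_normc mf; case: (mf) => mr mi.
have fine_le (h : T -> R) : measurable_fun setT h ->
    (forall x, `|h x| <= normc (f x)) ->
    ((`|\int[m]_x h x|%R)%:E <= \int[m]_x (normc (f x))%:E)%E.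
  move=> mh hf; apply: (@le_trans _ _ (`|\int[m]_x (h x)%:E|)%E).
    (* [fine] is 0 at the infinities, where the bound is trivial. *)
    by rewrite /Rintegral; case: (\int[m]_x _)%E => //= ; rewrite normr0 leey.
  apply: le_trans (le_abse_integral _ _ _) _ => //; first by solve_measurable.
  apply: ge0_le_integral => //.
  - by apply: measurableT_comp => //; solve_measurable.
  - by solve_measurable.
  - by move=> x _; rewrite lee_fin.
apply: (@le_trans _ _ ((`|\int[m]_x complex.Re (f x)|%R)%:E +
                       (`|\int[m]_x complex.Im (f x)|%R)%:E)%E).
  by rewrite -EFinD lee_fin; exact: ler_normc_ReIm.
rewrite mule_natl mule2n; apply: leeD; apply: fine_le => // x.
- exact: ler_normc_Re.
- exact: ler_normc_Im.
Qed.

Lemma cintegralD f g : cmeasurable f -> cmeasurable g ->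
  (\int[m]_x (normc (f x))%:E < +oo)%E ->
  (\int[m]_x (normc (g x))%:E < +oo)%E ->
  cintegral m (fun x => f x + g x) = cintegral m f + cintegral m g.
Proof.
move=> mf mg foo goo.
have [fr fi] := integrable_ReIm mf foo.
have [gr gi] := integrable_ReIm mg goo.
rewrite /cintegral; congr Complex.
  by rewrite -RintegralD//; apply: eq_Rintegral => x _;
     case: (f x) => a b; case: (g x).
by rewrite -RintegralD//; apply: eq_Rintegral => x _;
     case: (f x) => a b; case: (g x).
Qed.

End complex_measurable.

(** * Characters *)

Section complex_continuity.
Context (R : realType).

Lemma near_normc (T : Type) (F : set_system T) {FF : Filter F}
    (f : T -> R[i]) (z : R[i]) (e : R) :
  (f : T -> R[i]^o) @ F --> (z : R[i]^o) -> 0 < e ->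
  \forall x \near F, normc (z - f x) < e.
Proof.
move=> /cvgrPdist_lt fz e0.
have e0' : 0 < e%:C%C by rewrite ltcR.
apply: filterS (fz _ e0') => x.
by rewrite normc_def ltcR; case: (z - f x).
Qed.

Lemma continuous_cmeasurable (T : ptopologicalType) (f : T -> R[i]) :
  continuous (f : T -> R[i]^o) -> cmeasurable (f : borel T -> R[i]).
Proof.
move=> cf; split; apply: continuous_borel_measurable => x;
  apply/cvgrPdist_lt => e e0; apply: filterS (near_normc (cf x) e0) => y;
  apply: le_lt_trans.
- by rewrite (le_trans _ (ler_normc_Re _))//; case: (f x) => ? ?; case: (f y).
- by rewrite (le_trans _ (ler_normc_Im _))//; case: (f x) => ? ?; case: (f y).
Qed.

End complex_continuity.

Section characters.
Context (R : realType) (H : ptopologicalType) (K : hypergroup R H).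

Notation "chi ^~f" := (set_val chi : H -> R[i]) (at level 2, format "chi ^~f").

Lemma character_continuous (chi : dual K) :
  continuous (chi^~f : H -> R[i]^o).
Proof. by case: (set_valP chi). Qed.

Lemma character_cmeasurable (chi : dual K) :
  cmeasurable (chi^~f : borel H -> R[i]).
Proof. exact/continuous_cmeasurable/character_continuous. Qed.

Lemma normc_hg_eval_le (f : H -> R[i]) (B : R) x y :
  continuous (f : H -> R[i]^o) -> (forall x, normc (f x) <= B) ->
  normc (hg_eval K f x y) <= 2 * B.
Proof.
move=> cf fB; rewrite -lee_fin.
have mf := continuous_cmeasurable cf.
apply: le_trans (normc_cintegral_le _ mf) _.
rewrite EFinM lee_wpmul2l//; set m := hg_pconv _ _ _.
have m1 : (m setT = 1)%E := hg_probability K x y.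
rewrite -[leRHS]mule1 -m1 -integral_cst//.
apply: ge0_le_integral => //.
- by move=> z _; rewrite lee_fin normc_ge0.
- by apply/measurable_EFinP; exact: measurable_normc.
- by move=> z _; rewrite lee_fin.
Qed.

(** If [S] is the supremum of [normc chi], then
[chi x ^ 2 = chi (x * x)] gives [S ^ 2 <= 2 * S]. *)
Lemma character_le2 (chi : dual K) x : normc (chi^~f x) <= 2.
Proof.
have [cchi [B chiB] _ _ chiM] := set_valP chi.
pose E := range (fun x => normc (chi^~f x)).
have E0 : E !=set0 by exists (normc (chi^~f point)); exists point.
have hE : has_sup E.
  by split => //; exists B => _ [y _ <-]; exact: chiB.
have S0 : 0 <= sup E.
  by rewrite (le_trans (normc_ge0 (chi^~f x)))// ub_le_sup//; [case: hE|exists x].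
have supE y : normc (chi^~f y) <= sup E.
  by rewrite ub_le_sup//; [case: hE|exists y].
have sq y : normc (chi^~f y) ^+ 2 <= 2 * sup E.
  by rewrite expr2 -normcM -chiM; exact: normc_hg_eval_le.
have SS : sup E <= Num.sqrt (2 * sup E).
  apply: ge_sup => // _ [y _ <-].
  rewrite -[leLHS]ger0_norm ?normc_ge0// -(sqrtr_sqr (normc _)).
  by rewrite ler_wsqrtr//; exact: sq.
apply: (le_trans (supE x)).
have : sup E ^+ 2 <= 2 * sup E.
  rewrite -[leRHS]sqr_sqrtr ?mulr_ge0//.
  by rewrite lerXn2r ?nnegrE ?sqrtr_ge0.
by nra.
Qed.

(** The compact-open topology is that of uniform convergence on compact sets,
as characters are continuous. *)
Lemma near_dual (chi : dual K) (F : set H) (e : R) : compact F -> 0 < e ->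
  \forall chi' \near chi, forall x, F x -> normc (chi^~f x - chi'^~f x) < e.
Proof.
move=> cF e0.
have cv : {compact-open,
    (fun chi' : dual K => chi'^~f : H -> R[i]^o) @ chi -->
    (chi^~f : H -> R[i]^o)}.
  exact: (@initial_continuous _ _ (set_val : characters K -> _) chi).
have fc := (compact_open_fam_compactP (@character_continuous chi) _).1 cv.
have cvu := (fam_cvgP _ _ _).1 (fc _) F cF.
have FF : Filter ((fun chi' : dual K => chi'^~f) @ chi) by apply: fmap_filter; exact: nbhs_filter.
have e0' : 0 < e%:C%C by rewrite ltcR.
have : nbhs (chi^~f : {uniform` F -> R[i]^o})
    [set h : {uniform` F -> R[i]^o} | forall x, F x -> normc (chi^~f x - h x) < e].
  apply/uniform_nbhs; exists [set z : R[i]^o * R[i]^o | ball z.1 e%:C%C z.2].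
  split; first by rewrite -entourage_from_ballE; exists e%:C%C.
  move=> h /= hh y Fy; have := hh y Fy.
  by rewrite -ball_normE /= normc_def ltcR; case: (_ - _).
by move=> nb; exact: (cvu FF FF _ nb).
Qed.

End characters.

(** * Concentration of integrable functions on compact sets *)

(** Otherwise every layer [1/(n+1) <= v <= n+1] would miss a mass [e], and so
would their increasing union. *)
Lemma integrable_superlevel_cut (R : realType) d (T : measurableType d)
    (mu : {measure set T -> \bar R}) (v : T -> R) (e : R) :
  measurable_fun setT v -> (forall x, 0 <= v x) ->
  (\int[mu]_x (v x)%:E < +oo)%E -> 0 < e ->
  exists n : nat,
    (\int[mu]_x (v x * (~~ (n.+1%:R^-1 <= v x <= n.+1%:R))%R%:R)%:E <= e%:E)%E.
Proof.
move=> mv v0 voo e0; apply: contrapT => /forallNP tail.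
pose A n := fun x => (n.+1%:R^-1 <= v x <= n.+1%:R)%R.
have mA n : measurable_fun setT (A n) by rewrite /A; solve_measurable.
have Ifin : (\int[mu]_x (v x)%:E)%E \is a fin_num.
  by rewrite ge0_fin_numE//; apply: integral_ge0 => x _; rewrite lee_fin.
have : (\int[mu]_x (v x)%:E <= \int[mu]_x (v x)%:E - e%:E)%E.
  apply: (@ge0_integral_exhaust _ _ _ _ (fun n => [set x | A n x])) => //.
  - apply/nondecreasing_seqP => n; apply/subsetPset => x /= /andP[nv vn].
    rewrite /A (le_trans vn) ?ler_nat// andbT (le_trans _ nv)//.
    by rewrite lef_pV2 ?posrE// ler_nat.
  - by move=> n; rewrite -[X in measurable X]setTI; exact: mA.
  - move=> x vn0; have vx : 0 < v x by rewrite lt_neqAle eq_sym vn0 v0.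
    exists (Num.truncn (v x + (v x)^-1)) => /=; rewrite /A.
    have := truncnS_gt (v x + (v x)^-1).
    have vi0 : 0 <= (v x)^-1 by rewrite invr_ge0.
    move=> N; apply/andP; split; last by lra.
    by rewrite -[leRHS]invrK lef_pV2 ?posrE ?invr_gt0 ?ltr0Sn//; lra.
  - move=> n; rewrite leeBrDr// integral_patch_natr.
    have -> : (\int[mu]_x (v x)%:E = \int[mu]_x (v x * (A n x)%:R)%:E +
        \int[mu]_x (v x * (~~ A n x)%:R)%:E)%E.
      rewrite -ge0_integralD//.
      + apply: eq_integral => x _; rewrite -EFinD -mulrDr.
        by case: (A n x); rewrite /= ?addr0 ?add0r mulr1.
      + by move=> x _; rewrite lee_fin mulr_ge0.
      + by solve_measurable.
      + by move=> x _; rewrite lee_fin mulr_ge0.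
      + by solve_measurable; exact: measurable_neg.
    apply: leeD => //; rewrite leNgt; apply/negP => lt.
    by apply: (tail n); exact: ltW.
by rewrite -(fineK Ifin) -EFinB lee_fin; lra.
Qed.

Section radon.
Context (R : realType) (H : ptopologicalType).
Variable lambda : {measure set (borel H) -> \bar R}.
Hypotheses (hausdorffH : hausdorff_space H) (radonl : radon lambda).

Lemma compact_borel_measurable (F : set H) :
  compact F -> measurable (F : set (borel H)).
Proof.
move=> cF; rewrite -[F]setCK; apply: measurableC; apply: sub_sigma_algebra.
by apply: closed_openC; exact: compact_closed.
Qed.

(** The compact set need not be contained in [A], which allows to use inner
regularity of open sets only: take an open set of finite measure around [A], and
approximate that one from inside. *)
Lemma radon_compact_approx (A : set (borel H)) (e : R) :
  measurable A -> (lambda A < +oo)%E -> 0 < e ->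
  exists2 F : set H, compact F & (lambda (A `\` F) <= e%:E)%E.
Proof.
move=> mA Aoo e0; have [_ outer inner] := radonl.
have Afin : lambda A \is a fin_num by rewrite ge0_fin_numE.
have : (lambda A < lambda A + 1%:E)%E by rewrite lteDl// lte_fin.
rewrite {1}(outer _ mA) => /ereal_inf_lt[_ [U [oU AU] <-] Ult].
have mU : measurable (U : set (borel H)) by exact: sub_sigma_algebra.
have Ufin : lambda U \is a fin_num.
  by rewrite ge0_fin_numE// (lt_trans Ult)// lte_add_pinfty// ltry.
have : (lambda U - e%:E < lambda U)%E by rewrite lteBlDr// lteDl// lte_fin.
rewrite {2}(inner _ oU) => /ereal_sup_gt[_ [F [cF FU] <-] Flt].
exists F => //; have mF := compact_borel_measurable cF.
apply: (@le_trans _ _ (lambda (U `\` F))).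
  by apply: le_measure; rewrite ?inE//; [exact: measurableD|exact: measurableD|exact: setSD].
rewrite measureD//; last by rewrite -ge0_fin_numE.
have lFU : (lambda F <= lambda U)%E by apply: le_measure; rewrite ?inE.
rewrite (setIidr FU) leeBlDr; last first.
  by rewrite ge0_fin_numE// (le_lt_trans lFU)// -ge0_fin_numE.
by rewrite addeC -leeBlDr// ltW.
Qed.

(** Cut [v] to a layer where it is bounded and which has finite measure, then
approximate the layer by a compact set. *)
Lemma radon_integrable_tail (v : borel H -> R) (e : R) :
  measurable_fun setT v -> (forall x, 0 <= v x) ->
  (\int[lambda]_x (v x)%:E < +oo)%E -> 0 < e ->
  exists2 F : set H, compact F &
    (\int[lambda]_x (v x * \1_(~` F) x)%:E <= e%:E)%E.
Proof.
move=> mv v0 voo e0; have e20 : 0 < e / 2 by rewrite divr_gt0.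
have [n tail] := integrable_superlevel_cut mv v0 voo e20.
pose b x := (n.+1%:R^-1 <= v x <= n.+1%:R)%R.
have mb : measurable_fun setT b by rewrite /b; solve_measurable.
pose A := [set x | b x].
have mA : measurable A by rewrite -[X in measurable X]setTI; exact: mb.
have n0 : 0 < n.+1%:R :> R by rewrite ltr0Sn.
have Aoo : (lambda A < +oo)%E.
  rewrite -(integral_natr lambda mb).
  apply: (@le_lt_trans _ _ (\int[lambda]_x (n.+1%:R * v x)%:E)%E).
    apply: ge0_le_integral => //.
    - by solve_measurable.
    - by solve_measurable.
    - move=> x _; rewrite lee_fin /b; case: andP => [[bv _]|_]; last by rewrite mulr_ge0// ltW.
      by rewrite mulrC -ler_pdivrMr// mul1r.
  under eq_integral do rewrite EFinM.
  rewrite ge0_integralZl_EFin ?(ltW n0)//; try solve [by solve_measurable |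
    by move=> x _; rewrite lee_fin].
  by rewrite lte_mul_pinfty// lee_fin ltW.
have [F cF AF] := radon_compact_approx mA Aoo (divr_gt0 e20 n0).
exists F => //; have mF := compact_borel_measurable cF.
have mFC : measurable_fun setT (\1_(~` F) : borel H -> R).
  by apply: measurable_indic; exact: measurableC.
have mAF : measurable_fun setT (\1_(A `\` F) : borel H -> R).
  by apply: measurable_indic; exact: measurableD.
apply: (@le_trans _ _ (\int[lambda]_x (v x * (~~ b x)%:R)%:E +
    \int[lambda]_x (n.+1%:R * \1_(A `\` F) x)%:E)%E).
  have mnb : measurable_fun setT (fun x => ~~ b x) by exact: measurable_neg.
  rewrite -ge0_integralD//; try solve [by solve_measurable |
    by move=> x _; rewrite lee_fin mulr_ge0 ?(ltW n0)].
  apply: ge0_le_integral => //.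
  - by move=> x _; rewrite lee_fin mulr_ge0.
  - by solve_measurable.
  - by apply: emeasurable_funD; solve_measurable.
  move=> x _; rewrite -EFinD lee_fin !indicE in_setD in_setC.
  have [bx|nbx] := boolP (b x); last first.
    rewrite mulr1 (le_trans (y := v x))//.
      by rewrite -[leRHS]mulr1 ler_wpM2l//; case: (x \in F).
    by rewrite lerDl mulr_ge0 // ltW.
  rewrite mulr0 add0r (_ : x \in A); last by rewrite inE.
  by rewrite ler_wpM2r//; case/andP: bx.
have -> : e = e / 2 + e / 2 by field.
rewrite EFinD; apply: leeD => //.
under eq_integral do rewrite EFinM.
rewrite ge0_integralZl_EFin ?(ltW n0)//; try solve [by solve_measurable |
    by move=> x _; rewrite lee_fin].
rewrite integral_indic//; last exact: measurableD.
rewrite setIT -lee_pdivlMl// -EFinM mulrC; exact: AF.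
Qed.

End radon.

(** * The Fourier transform of an integrable function *)

Section cnorm.
Context d (T : measurableType d) (R : realType).
Variable m : {measure set T -> \bar R}.
Implicit Types f g : T -> R[i].

Lemma poweR_cnorm p f : 0 < p ->
  (cnorm m p f `^ p = \int[m]_x (normc (f x) `^ p)%:E)%E.
Proof.
move=> p0; rewrite /cnorm poweR_Lnorm; last by rewrite gt_eqF.
apply: eq_integral => x _ /=.
by rewrite ger0_norm ?normc_ge0// poweR_EFin.
Qed.

Lemma cLp_lty p f : 0 < p -> cLp m p f ->
  (\int[m]_x (normc (f x) `^ p)%:E < +oo)%E.
Proof. by move=> p0 [_ foo]; rewrite -poweR_cnorm// poweR_lty. Qed.

Lemma lty_cLp p f : 0 < p -> cmeasurable f ->
  (\int[m]_x (normc (f x) `^ p)%:E < +oo)%E -> cLp m p f.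
Proof.
move=> p0 mf foo; split => //; move: foo; rewrite -poweR_cnorm//.
by apply: lty_poweRy; rewrite gt_eqF.
Qed.

Lemma cLp1_lty f : cLp m 1 f -> (\int[m]_x (normc (f x))%:E < +oo)%E.
Proof.
move=> /(cLp_lty ltr01); apply: le_lt_trans.
by under eq_integral do rewrite -[normc _]powRr1 ?normc_ge0//.
Qed.

Lemma cnorm_le_add p f g : 1 <= p -> cmeasurable f -> cmeasurable g ->
  (cnorm m p g <= cnorm m p f + cnorm m p (fun x => (g x - f x)%R))%E.
Proof.
move=> p1 mf mg; have mgf := cmeasurableD mg (cmeasurableN mf).
have mnf := measurable_normc mf; have mngf := measurable_normc mgf.
apply: le_trans (minkowski_EFin _ mnf mngf p1).
rewrite /cnorm unlock /=.
have p0 : 0 < p by lra.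
apply: gt0_ler_poweR; first by rewrite invr_ge0 ltW.
- rewrite in_itv/= leey andbT.
  by apply: integral_ge0 => x _; rewrite lee_fin powR_ge0.
- rewrite in_itv/= leey andbT.
  by apply: integral_ge0 => x _; rewrite lee_fin powR_ge0.
have msum := measurable_funD mnf mngf.
apply: ge0_le_integral => //.
- apply/measurable_EFinP; apply: measurable_powRr.
  by apply: measurableT_comp => //; exact: measurable_normc.
- apply/measurable_EFinP; apply: measurable_powRr.
  exact: measurableT_comp.
move=> x _; rewrite lee_fin !ger0_norm ?addr_ge0 ?normc_ge0//.
rewrite ge0_ler_powR ?nnegrE ?addr_ge0 ?normc_ge0 ?(ltW p0)//.
by rewrite (le_trans _ (le_normcD _ _))// addrC subrK.
Qed.

End cnorm.

Section fourier.
Context (R : realType) (H : ptopologicalType) (K : hypergroup R H).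
Variable lambda : {measure set (borel H) -> \bar R}.
Implicit Types (u v : borel H -> R[i]) (chi : dual K).

Let integrand_measurable u chi : cmeasurable u ->
  cmeasurable (fun x : borel H => u x * ((set_val chi : H -> R[i]) x)^*%C).
Proof.
move=> mu; apply: cmeasurableM => //; apply: cmeasurableJ.
exact: character_cmeasurable.
Qed.

Let integrand_lty u chi : cmeasurable u ->
  (\int[lambda]_x (normc (u x))%:E < +oo)%E ->
  (\int[lambda]_x
     (normc (u x * ((set_val chi : H -> R[i]) x)^*%C))%:E <=
   2%:E * \int[lambda]_x (normc (u x))%:E)%E.
Proof.
move=> mu uoo; have mn := measurable_normc mu.
rewrite -ge0_integralZl_EFin//; try solve [by solve_measurable |
    by move=> x _; rewrite lee_fin normc_ge0].
apply: ge0_le_integral => //.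
- by move=> x _; rewrite lee_fin normc_ge0.
- by apply/measurable_EFinP; exact: measurable_normc (integrand_measurable chi mu).
- by solve_measurable.
move=> x _; rewrite -EFinM lee_fin normcM normcJ mulrC ler_wpM2r ?normc_ge0//.
exact: character_le2.
Qed.

Lemma normc_fourier_le u chi : cmeasurable u ->
  (\int[lambda]_x (normc (u x))%:E < +oo)%E ->
  ((normc (fourier lambda u chi))%:E <=
   4%:E * \int[lambda]_x (normc (u x))%:E)%E.
Proof.
move=> mu uoo.
apply: le_trans (normc_cintegral_le _ (integrand_measurable chi mu)) _.
have -> : 4 = 2 * 2 :> R by ring.
by rewrite [in leRHS]EFinM -muleA lee_wpmul2l// integrand_lty.
Qed.

Lemma fourierD u v chi : cmeasurable u -> cmeasurable v ->
  (\int[lambda]_x (normc (u x))%:E < +oo)%E ->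
  (\int[lambda]_x (normc (v x))%:E < +oo)%E ->
  fourier lambda (fun x => u x + v x) chi =
  fourier lambda u chi + fourier lambda v chi.
Proof.
move=> mu mv uoo voo; rewrite /fourier -cintegralD//; first last.
- by apply: le_lt_trans (integrand_lty _ _ _) _ => //; rewrite lte_mul_pinfty.
- by apply: le_lt_trans (integrand_lty _ _ _) _ => //; rewrite lte_mul_pinfty.
- exact: integrand_measurable.
- exact: integrand_measurable.
by congr cintegral; apply/funext => x; rewrite mulrDl.
Qed.

Hypothesis radonl : radon lambda.

(** Outside a compact set [F] carrying most of [u] use that characters are
bounded by 2, on [F] use that [chi'] is uniformly close to [chi]. *)
Lemma fourier_continuous u : cmeasurable u ->
  (\int[lambda]_x (normc (u x))%:E < +oo)%E ->
  continuous (fourier lambda u : dual K -> R[i]^o).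
Proof.
move=> mu uoo chi; have chiF := nbhs_filter chi.
apply/cvgrPdist_lt => z z0.
(* The norm of the complex plane is itself complex-valued, so that its positive
   elements are the positive reals. *)
pose e := complex.Re z.
have ze : z = e%:C%C.
  by move: z0; rewrite ltcE /e; case: (z) => a b /= /andP[/eqP -> _].
have e0 : 0 < e by move: z0; rewrite ze ltcR.
have mn := measurable_normc mu.
pose I := fine (\int[lambda]_x (normc (u x))%:E)%E.
have Ige0 : (0 <= \int[lambda]_x (normc (u x))%:E)%E.
  by apply: integral_ge0 => x _; rewrite lee_fin normc_ge0.
have IE : (\int[lambda]_x (normc (u x))%:E = I%:E)%E.
  by rewrite fineK// ge0_fin_numE.
have I0 : 0 <= I by rewrite fine_ge0.
have e16 : 0 < e / 16 by rewrite divr_gt0.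
have [F cF tailF] := radon_integrable_tail (hg_hausdorff K) radonl mn
  (fun x => normc_ge0 _) uoo e16.
have del0 : 0 < e / (4 * (I + 1)) by rewrite divr_gt0// mulr_gt0// ltr_wpDl.
apply: (@filterS _ (nbhs chi) (nbhs_filter chi) _ _ _ (near_dual chi cF del0)).
move=> chi' near'.
rewrite ze normc_def ltcR.
suff : normc (fourier lambda u chi - fourier lambda u chi') < e.
  by case: (_ - _).
have mF : measurable (~` F : set (borel H)).
  by apply: measurableC; exact: compact_borel_measurable (hg_hausdorff K) _ cF.
have mFC : measurable_fun setT (\1_(~` F) : borel H -> R).
  exact: measurable_indic.
pose g (x : borel H) := u x * ((set_val chi : H -> R[i]) x)^*%C -
  u x * ((set_val chi' : H -> R[i]) x)^*%C.
have mg : cmeasurable g.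
  by apply: cmeasurableD; [|apply: cmeasurableN]; exact: integrand_measurable.
have gle : (\int[lambda]_x (normc (g x))%:E <=
    (e / (4 * (I + 1)))%:E * \int[lambda]_x (normc (u x))%:E +
    4%:E * \int[lambda]_x (normc (u x) * \1_(~` F) x)%:E)%E.
  have c0 := ltW del0.
  rewrite -!ge0_integralZl_EFin//; try solve [by solve_measurable |
    by move=> x _; rewrite lee_fin ?mulr_ge0 ?normc_ge0].
  rewrite -ge0_integralD//; try solve [by solve_measurable |
    by move=> x _; rewrite -EFinM lee_fin mulr_ge0// ?mulr_ge0 ?normc_ge0].
  apply: ge0_le_integral => //.
  - by move=> x _; rewrite lee_fin normc_ge0.
  - by apply/measurable_EFinP; exact: measurable_normc.
  - by apply: emeasurable_funD; solve_measurable.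
  move=> x _; rewrite -!EFinM -EFinD lee_fin /g -mulrBr normcM.
  rewrite -raddfB normcJ indicE in_setC.
  have [xF|xF] := boolP (x \in F).
    rewrite mulr0 mulr0 addr0 mulrC ler_wpM2r ?normc_ge0//.
    by apply/ltW/near'; rewrite inE in xF.
  rewrite mulr1 (le_trans (y := 4 * normc (u x)))//; last first.
    by rewrite lerDr mulr_ge0 ?normc_ge0.
  rewrite mulrC ler_wpM2r ?normc_ge0// (le_trans (le_normcD _ _))// normcN.
  by have := character_le2 chi x; have := character_le2 chi' x; lra.
have goo : (\int[lambda]_x (normc (g x))%:E < (e / 2)%:E)%E.
  apply: (le_lt_trans gle); rewrite IE.
  apply: (@le_lt_trans _ _ ((e / (4 * (I + 1)))%:E * I%:E + 4%:E * (e / 16)%:E)%E).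
    by apply: leeD => //; exact: lee_wpmul2l.
  rewrite -!EFinM -EFinD lte_fin.
  have -> : e / 2 = e / 4 + 4 * (e / 16) by field.
  rewrite ltrD2r invfM mulrA -[ltLHS]mulrA gtr_pMr ?divr_gt0//.
  by rewrite mulrC ltr_pdivrMr ?mul1r ?ltrDl// ltr_wpDl.
have -> : fourier lambda u chi - fourier lambda u chi' = cintegral lambda g.
  rewrite /fourier; apply/eqP; rewrite subr_eq -cintegralD//.
  - by apply/eqP; congr cintegral; apply/funext => x; rewrite /g subrK.
  - exact: integrand_measurable.
  - exact: lt_trans goo (ltry _).
  - by apply: le_lt_trans (integrand_lty _ _ _) _ => //; rewrite lte_mul_pinfty.
rewrite -lte_fin; apply: (le_lt_trans (normc_cintegral_le _ mg)).
have -> : e = 2 * (e / 2) by field.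
by rewrite [ltRHS]EFinM lte_pmul2l// lte_fin.
Qed.

Lemma fourier_cmeasurable u : cmeasurable u ->
  (\int[lambda]_x (normc (u x))%:E < +oo)%E ->
  cmeasurable (fourier lambda u : borel (dual K) -> R[i]).
Proof.
by move=> mu uoo; apply: continuous_cmeasurable; exact: fourier_continuous.
Qed.

End fourier.

(** * Weighted inequalities for functions in L^1 and L^2 *)

Section nice_functions.
Context (R : realType) (H : ptopologicalType) (K : hypergroup R H).
Variables (lambda : {measure set (borel H) -> \bar R})
          (pi : {measure set (borel (dual K)) -> \bar R}).
Hypotheses (radonl : radon lambda) (plan : plancherel lambda pi).
Variable u : borel H -> R[i].
Hypotheses (u1 : cLp lambda 1 u) (u2 : cLp lambda 2 u).

Let mu : cmeasurable u. Proof. by case: u1. Qed.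
Let mnu : measurable_fun setT (fun x => normc (u x)).
Proof. exact: measurable_normc. Qed.
Let uoo : (\int[lambda]_x (normc (u x))%:E < +oo)%E.
Proof. exact: cLp1_lty. Qed.

Let cut (b : borel H -> bool) (x : borel H) : R[i] := u x * ((b x)%:R)%:C%C.

Let normc_cut b x : normc (cut b x) = normc (u x) * (b x)%:R.
Proof.
by rewrite /cut normcM /= expr0n /= addr0 sqrtr_sqr ger0_norm.
Qed.

Let cut_measurable b : measurable_fun setT b -> cmeasurable (cut b).
Proof.
by move=> mb; apply: cmeasurableM => //; apply: cmeasurable_real; solve_measurable.
Qed.

Let cut_le (p : R) b : 0 < p -> measurable_fun setT b ->
  (\int[lambda]_x (normc (cut b x) `^ p)%:E <=
   \int[lambda]_x (normc (u x) `^ p)%:E)%E.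
Proof.
move=> p0 mb; have mnc := measurable_normc (cut_measurable mb).
apply: ge0_le_integral => //.
- by move=> x _; rewrite lee_fin powR_ge0.
- by apply/measurable_EFinP; exact: measurable_powRr mnc.
- by solve_measurable.
move=> x _; rewrite lee_fin normc_cut ge0_ler_powR ?nnegrE ?(ltW p0) ?mulr_ge0 ?normc_ge0//.
by case: (b x); rewrite /= ?mulr1 ?mulr0 ?normc_ge0.
Qed.

Let cut_cLp (p : R) b : 0 < p -> measurable_fun setT b ->
  cLp lambda p u -> cLp lambda p (cut b).
Proof.
move=> p0 mb up; apply: lty_cLp => //; first exact: cut_measurable.
exact: le_lt_trans (cut_le p0 mb) (cLp_lty p0 up).
Qed.

Let low (c : R) (x : borel H) := (normc (u x) <= c)%R.
Let high (c : R) (x : borel H) := (c < normc (u x))%R.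
Let mlow c : measurable_fun setT (low c).
Proof. by rewrite /low; solve_measurable. Qed.
Let mhigh c : measurable_fun setT (high c).
Proof. by rewrite /high; solve_measurable. Qed.

Let g chi := normc (fourier lambda u (chi : dual K)).
Let h c chi := normc (fourier lambda (cut (low c)) (chi : dual K)).
Let J c : R := fine (4%:E * \int[lambda]_x (normc (cut (high c) x))%:E)%E.

Let cutoo b : measurable_fun setT b ->
  (\int[lambda]_x (normc (cut b x))%:E < +oo)%E.
Proof. by move=> mb; apply: cLp1_lty; exact: cut_cLp. Qed.

Let JE c : (4%:E * \int[lambda]_x (normc (cut (high c) x))%:E = (J c)%:E)%E.
Proof.
rewrite /J fineK// fin_numM// ge0_fin_numE ?cutoo//.
by apply: integral_ge0 => x _; rewrite lee_fin normc_ge0.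
Qed.

Let g_measurable : measurable_fun setT (g : borel (dual K) -> R).
Proof. by apply: measurable_normc; exact: fourier_cmeasurable. Qed.

Let h_measurable c : measurable_fun setT (h c : borel (dual K) -> R).
Proof.
apply: measurable_normc; apply: fourier_cmeasurable => //.
- exact: cut_measurable.
- exact: cutoo.
Qed.

Let g_le_split (c : R) chi : 0 < c -> g chi <= h c chi + J c.
Proof.
move=> _.
have uE : u = (fun x => cut (low c) x + cut (high c) x).
  apply/funext => x; rewrite /cut /low /high -mulrDr.
  by case: leP => _; rewrite /= -rmorphD /= ?addr0 ?add0r mulr1.
have -> : g chi = normc (fourier lambda (cut (low c)) chi +
                         fourier lambda (cut (high c)) chi).
  rewrite /g -fourierD -?uE//; try exact: cut_measurable; exact: cutoo.
apply: (le_trans (le_normcD _ _)); rewrite lerD2l -lee_fin -JE.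
apply: normc_fourier_le; [exact: cut_measurable|exact: cutoo].
Qed.

Let plancherel_sqr v : cLp lambda 1 v -> cLp lambda 2 v ->
  (\int[pi]_chi (normc (fourier lambda v chi) ^+ 2)%:E =
   \int[lambda]_x (normc (v x) ^+ 2)%:E)%E.
Proof. by move=> v1 v2; rewrite plan. Qed.

Let h_L2 (c : R) : 0 < c ->
  (\int[pi]_chi (h c chi ^+ 2)%:E <=
   \int[lambda]_x (normc (u x) ^+ 2 * (normc (u x) <= c)%R%:R)%:E)%E.
Proof.
move=> _; rewrite plancherel_sqr; [|exact: cut_cLp|exact: cut_cLp].
rewrite le_eqVlt; apply/orP; left; apply/eqP; apply: eq_integral => x _.
rewrite normc_cut exprMn /low; congr (_%:E); congr (_ * _).
by case: (_ <= _); rewrite ?expr1n ?expr0n.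
Qed.

Let J_L1 (c : R) : 0 < c ->
  ((J c)%:E <= 4%:E *
    \int[lambda]_x (normc (u x) * (c < normc (u x))%R%:R)%:E)%E.
Proof. by move=> _; rewrite -JE; under eq_integral do rewrite normc_cut. Qed.

Let J_ge0 c : 0 <= J c.
Proof.
rewrite -lee_fin -JE mule_ge0//.
by apply: integral_ge0 => x _; rewrite lee_fin normc_ge0.
Qed.

Lemma paley_fourier (p : R) (psi : borel (dual K) -> R) (M : R) :
  1 < p -> p < 2 -> measurable_fun setT psi -> (forall chi, 0 <= psi chi) ->
  0 < M ->
  (forall t : R, 0 < t -> (t%:E * pi [set chi | (t <= psi chi)%R] <= M%:E)%E) ->
  (\int[pi]_chi
     (normc (fourier lambda u chi) `^ p * psi chi `^ (2 - p))%:E <=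
   (paley_const 4 p * M `^ (2 - p))%:E *
     \int[lambda]_x (normc (u x) `^ p)%:E)%E.
Proof.
move=> p1 p2 mpsi psi0 M0 weak.
apply: (@paley_le _ _ _ _ _ lambda pi 4 p (fun x => normc (u x)) g h J) => //.
- by move=> x; exact: normc_ge0.
- by move=> y; exact: normc_ge0.
- by move=> c y; exact: normc_ge0.
Qed.

(** The transform is bounded and square integrable. *)
Lemma fourier_power_lty (q : R) : 2 <= q ->
  (\int[pi]_chi (normc (fourier lambda u chi) `^ q)%:E < +oo)%E.
Proof.
move=> q2.
pose B := fine (4%:E * \int[lambda]_x (normc (u x))%:E)%E.
have BE : (4%:E * \int[lambda]_x (normc (u x))%:E = B%:E)%E.
  rewrite /B fineK// fin_numM// ge0_fin_numE//.
  by apply: integral_ge0 => x _; rewrite lee_fin normc_ge0.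
have gB chi : g chi <= B by rewrite -lee_fin -BE; exact: normc_fourier_le.
have mg := g_measurable.
apply: (@le_lt_trans _ _ ((B `^ (q - 2))%:E * \int[pi]_chi (g chi ^+ 2)%:E)%E).
  rewrite -ge0_integralZl_EFin ?powR_ge0//; try solve [by solve_measurable |
    by move=> y _; rewrite lee_fin sqr_ge0].
  apply: ge0_le_integral => //.
  - by move=> y _; rewrite lee_fin powR_ge0.
  - by solve_measurable.
  - by solve_measurable.
  move=> y _; rewrite -EFinM lee_fin -/(g y).
  have [->|gn0] := eqVneq (g y) 0.
    by rewrite powR0 ?mulr_ge0 ?powR_ge0 ?sqr_ge0// gt_eqF//; lra.
  have gy : 0 < g y by rewrite lt_neqAle eq_sym gn0 normc_ge0.
  have -> : g y `^ q = g y `^ (q - 2) * g y ^+ 2.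
    by rewrite -powR_mulrn ?(ltW gy)// -powRD_gt0// subrK.
  rewrite ler_wpM2r ?sqr_ge0// ge0_ler_powR ?nnegrE ?(ltW gy) ?subr_ge0//.
  by rewrite (le_trans _ (gB y))// ltW.
rewrite lte_mul_pinfty ?lee_fin ?powR_ge0// plancherel_sqr//.
have := cLp_lty (ltr0n _ 2) u2.
by under eq_integral do rewrite powR_mulrn ?normc_ge0//.
Qed.

Lemma hausdorff_young_fourier (p N : R) : 1 < p -> p < 2 -> 0 < N ->
  (\int[lambda]_x (normc (u x) `^ p)%:E <= (N `^ p)%:E)%E ->
  (\int[pi]_chi (normc (fourier lambda u chi) `^ (p / (p - 1)))%:E <=
   (paley_const 4 p `^ (p - 1)^-1 * N `^ (p / (p - 1)))%:E)%E.
Proof.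
move=> p1 p2 N0 uN.
apply: (@hausdorff_young_le _ _ _ _ _ lambda pi 4 p (fun x => normc (u x)) g h J) => //.
- by move=> x; exact: normc_ge0.
- by move=> y; exact: normc_ge0.
- by move=> c y; exact: normc_ge0.
- by apply: fourier_power_lty; rewrite ler_pdivlMr; lra.
Qed.

Lemma plancherel_powR (N : R) :
  (\int[lambda]_x (normc (u x) `^ 2)%:E <= (N `^ 2)%:E)%E ->
  (\int[pi]_chi (normc (fourier lambda u chi) `^ 2)%:E <= (N `^ 2)%:E)%E.
Proof.
under eq_integral do rewrite powR_mulrn ?normc_ge0//.
move=> uN; under eq_integral do rewrite powR_mulrn ?normc_ge0//.
by rewrite plancherel_sqr.
Qed.

End nice_functions.

(** Sum of the constants of the two endpoints; at [p = 2] both endpoints are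
Plancherel's identity, with constant 1. *)
Definition fourier_const (R : realType) (p : R) : R :=
  if p < 2 then paley_const 4 p + paley_const 4 p `^ (p - 1)^-1 else 2.

Lemma fourier_const_gt0 (R : realType) (p : R) : 1 < p -> 0 < fourier_const p.
Proof.
rewrite /fourier_const => p1; case: ifPn => // p2.
by rewrite ltr_pwDl ?powR_ge0// paley_const_gt0.
Qed.

Lemma fourier_weighted_le (R : realType) (H : ptopologicalType)
    (K : hypergroup R H) (lambda : {measure set (borel H) -> \bar R})
    (pi : {measure set (borel (dual K)) -> \bar R}) (p b M N : R)
    (psi : borel (dual K) -> R) (u : borel H -> R[i]) :
  radon lambda -> plancherel lambda pi -> 1 < p -> p <= 2 -> p <= b ->
  b <= p / (p - 1) -> 0 < M -> 0 < N ->
  measurable_fun setT psi -> (forall chi, 0 < psi chi) ->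
  (forall t : R, 0 < t -> (t%:E * pi [set chi | (t <= psi chi)%R] <= M%:E)%E) ->
  cLp lambda 1 u -> cLp lambda 2 u ->
  (\int[lambda]_x (normc (u x) `^ p)%:E <= (N `^ p)%:E)%E ->
  (\int[pi]_chi (normc (fourier lambda u chi) `^ b *
                 psi chi `^ (1 - b / (p / (p - 1))))%:E <=
   (fourier_const p * M `^ (1 - b / (p / (p - 1))) * N `^ b)%:E)%E.
Proof.
move=> radonl plan p1 p2 pb bq M0 N0 mpsi psi0 weak u1 u2 uN.
have mu : cmeasurable u by case: u1.
have p0 : 0 < p by lra.
have mg : measurable_fun setT
    ((fun chi => normc (fourier lambda u chi)) : borel (dual K) -> R).
  by apply: measurable_normc; apply: fourier_cmeasurable => //; exact: cLp1_lty.
have pq : 1 - p / (p / (p - 1)) = 2 - p by field; lra.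
rewrite /fourier_const; case: ltP => [p2'|p2'].
  apply: (@interpolation_le _ _ _ _ _ _ p) => //;
    [by move=> ?; exact: normc_ge0|rewrite pq|].
    apply: (le_trans (paley_fourier radonl plan u1 u2 p1 p2' mpsi _ M0 weak)).
      by move=> chi; exact: ltW.
    rewrite [leRHS]EFinM lee_wpmul2l// lee_fin mulr_ge0 ?powR_ge0//.
    by apply/ltW/paley_const_gt0.
  exact: hausdorff_young_fourier.
have p2E : p = 2 by apply/le_anti; rewrite p2 p2'.
have two : 2 = 1 + 1 :> R by ring.
rewrite two.
apply: (@interpolation_le _ _ _ _ _ _ p) => //;
    [by move=> ?; exact: normc_ge0|rewrite pq|].
  rewrite p2E subrr !powRr0 !mul1r.
  under eq_integral do rewrite powRr0 mulr1.
  by apply: plancherel_powR => //; rewrite -p2E.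
rewrite p2E mul1r.
have -> : 2 / (2 - 1) = 2 :> R by field; lra.
by apply: plancherel_powR => //; rewrite -p2E.
Qed.

(** * The inequality on L^p *)

Lemma cvge0_near_lt (R : realType) (x : nat -> \bar R) (e : R) :
  x n @[n --> \oo] --> 0%E -> 0 < e -> \forall n \near \oo, (x n < e%:E)%E.
Proof.
move=> x0 e0.
have nb : nbhs (0%E : \bar R) [set y : \bar R | (y < e%:E)%E].
  rewrite /nbhs /= /ereal_nbhs /=.
  have : nbhs (0 : R) [set y : R | y < e] by exact: lt_nbhsl.
  by apply: filterS => y /=; rewrite lte_fin.
exact: (x0 _ nb).
Qed.

(** A strict bound [N] on the norm of [f] is eventually a bound on the norms of the
approximating functions, so the constants do not change along the
approximation. *)
Lemma fourier_Lp_weighted_le (R : realType) (H : ptopologicalType)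
    (K : hypergroup R H) (lambda : {measure set (borel H) -> \bar R})
    (pi : {measure set (borel (dual K)) -> \bar R}) (p b M N : R)
    (psi : borel (dual K) -> R)
    (f : borel H -> R[i]) (fhat : borel (dual K) -> R[i]) :
  radon lambda -> plancherel lambda pi -> 1 < p -> p <= 2 -> p <= b ->
  b <= p / (p - 1) -> 0 < M -> 0 < N ->
  measurable_fun setT psi -> (forall chi, 0 < psi chi) ->
  (forall t : R, 0 < t -> (t%:E * pi [set chi | (t <= psi chi)%R] <= M%:E)%E) ->
  cLp lambda p f -> fourier_Lp lambda pi p f fhat ->
  (cnorm lambda p f < N%:E)%E ->
  (\int[pi]_chi (normc (fhat chi) `^ b *
                 psi chi `^ (1 - b / (p / (p - 1))))%:E <=
   (2 `^ b *
    (fourier_const p * M `^ (1 - b / (p / (p - 1))) * N `^ b))%:E)%E.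
Proof.
move=> radonl plan p1 p2 pb bq M0 N0 mpsi psi0 weak fp [fhq [u [u12 uf uh]]] fN.
have p0 : 0 < p by lra.
have b0 : 0 < b by lra.
have q0 : 0 < p / (p - 1) by rewrite divr_gt0//; lra.
have mf : cmeasurable f by case: fp.
have mfh : cmeasurable fhat by case: fhq.
have mu n : cmeasurable (u n) by case: (u12 n) => -[].
have mhat n : cmeasurable (fourier lambda (u n) : borel (dual K) -> R[i]).
  by apply: fourier_cmeasurable => //; apply: cLp1_lty; case: (u12 n).
apply: (@integral_perturb_le _ _ _ _ _ _ _ (p / (p - 1))) => //.
- exact: measurable_normc.
- by move=> y; exact: normc_ge0.
- by solve_measurable.
- by move=> y; exact: powR_ge0.
move=> eps eps0.
have Ffin : cnorm lambda p f \is a fin_num.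
  by rewrite ge0_fin_numE ?Lnorm_ge0//; case: fp.
have FN : 0 < N - fine (cnorm lambda p f).
  by rewrite subr_gt0 -lte_fin fineK.
have eps10 : 0 < eps `^ (p / (p - 1))^-1 by rewrite powR_gt0.
have [n [un hn]] : exists n,
    (cnorm lambda p (fun x => (u n x - f x)%R) <
       (N - fine (cnorm lambda p f))%:E)%E /\
    (cnorm pi (p / (p - 1)) (fun chi => (fourier lambda (u n) chi - fhat chi)%R) <
       (eps `^ (p / (p - 1))^-1)%:E)%E.
  have [n _ nP] := filterI (cvge0_near_lt uf FN) (cvge0_near_lt uh eps10).
  by exists n; exact: (nP n (leqnn n)).
have mhf : cmeasurable (fun chi : borel (dual K) => fourier lambda (u n) chi - fhat chi).
  by apply: cmeasurableD => //; exact: cmeasurableN.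
exists (fun chi => normc (fourier lambda (u n) chi)),
       (fun chi => normc (fourier lambda (u n) chi - fhat chi)).
have le_pow (x : \bar R) (r c : R) : 0 < r -> 0 <= c ->
    (0 <= x)%E -> (x <= c%:E)%E -> (x `^ r <= (c `^ r)%:E)%E.
  move=> r0 c0 x0 xc; rewrite -poweR_EFin.
  by apply: gt0_ler_poweR; rewrite ?in_itv/= ?leey ?andbT ?lee_fin ?(ltW r0).
split.
- by split; exact: measurable_normc.
- by move=> y; rewrite !normc_ge0.
- move=> y; rewrite -lerBlDl; apply: le_trans (ler_norm _) _.
  by rewrite distrC; exact: ler_normcB.
- case: (u12 n) => un1 un2; apply: fourier_weighted_le => //.
  rewrite -poweR_cnorm//; apply: le_pow => //; first exact: ltW.
    exact: Lnorm_ge0.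
  apply: (le_trans (cnorm_le_add _ (ltW p1) mf (mu n))).
  rewrite -(fineK Ffin); apply: (le_trans (leeD (lexx _) (ltW un))).
  by rewrite -EFinD lee_fin addrC subrK.
- rewrite -poweR_cnorm//.
  have -> : eps = (eps `^ (p / (p - 1))^-1) `^ (p / (p - 1)).
    by rewrite -powRrM mulVf ?powRr1 ?(ltW eps0)// gt_eqF.
  by apply: le_pow => //; [exact: ltW|exact: Lnorm_ge0|exact: ltW].
Qed.

(** The measure itself vanishes, being carried by the union of the sets
[1/(n+1) <= psi]. *)
Lemma integral_weak_sup0 (R : realType) d (Y : measurableType d)
    (nu : {measure set Y -> \bar R}) (psi g : Y -> R) :
  measurable_fun setT psi -> (forall y, 0 < psi y) ->
  measurable_fun setT g -> (forall y, 0 <= g y) ->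
  (forall t : R, 0 < t -> nu [set y | (t <= psi y)%R] = 0%E) ->
  (\int[nu]_y (g y)%:E = 0)%E.
Proof.
move=> mpsi psi0 mg g0 null; apply/eqP; rewrite eq_le; apply/andP; split; last first.
  by apply: integral_ge0 => y _; rewrite lee_fin.
apply: (@ge0_integral_exhaust _ _ _ _ (fun n => [set y | (n.+1%:R^-1 <= psi y)%R])) => //.
- apply/nondecreasing_seqP => n; apply/subsetPset => y /=; apply: le_trans.
  by rewrite lef_pV2 ?posrE// ler_nat.
- move=> n; rewrite -[X in measurable X]setTI.
  exact: (measurable_fun_ler (f := cst n.+1%:R^-1) _ mpsi).
- move=> y _; exists (Num.truncn (psi y)^-1) => /=.
  rewrite -[leRHS]invrK lef_pV2 ?posrE ?invr_gt0 ?ltr0Sn//.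
  exact/ltW/truncnS_gt.
- move=> n; rewrite null_set_integral// ?null ?invr_gt0 ?ltr0Sn//.
    rewrite -[X in measurable X]setTI.
    exact: (measurable_fun_ler (f := cst n.+1%:R^-1) _ mpsi).
  by apply: measurable_funTS; solve_measurable.
Qed.

Theorem theorem1p2 (R : realType) (H : ptopologicalType) (K : hypergroup R H)
    (lambda : {measure set (borel H) -> \bar R})
    (pi : {measure set (borel (dual K)) -> \bar R}) (p b : R) :
  commutative_hypergroup K -> haar K lambda -> plancherel lambda pi ->
  1 < p -> p <= 2 -> p <= b -> b <= p / (p - 1) ->
  exists2 C : R, 0 < C &
  forall psi : borel (dual K) -> R, measurable_fun setT psi ->
  (forall chi, 0 < psi chi) -> (weak_sup pi psi < +oo)%E ->
  forall (f : borel H -> R[i]) (fhat : borel (dual K) -> R[i]),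
  cLp lambda p f -> fourier_Lp lambda pi p f fhat ->
  ((\int[pi]_chi
      ((normc (fhat chi) * psi chi `^ (b^-1 - (p / (p - 1))^-1)) `^ b)%:E) `^ b^-1
   <= C%:E * weak_sup pi psi `^ (b^-1 - (p / (p - 1))^-1) * cnorm lambda p f)%E.
Proof.
move=> _ [radonl _ _] plan p1 p2 pb bq; set a := b^-1 - _.
have b0 : 0 < b by lra.
have q0 : 0 < p / (p - 1) by rewrite divr_gt0//; lra.
have A0 : 0 < 2 `^ b * fourier_const p.
  by rewrite mulr_gt0 ?powR_gt0// fourier_const_gt0.
exists ((2 `^ b * fourier_const p) `^ b^-1); first by rewrite powR_gt0.
move=> psi mpsi psi0 supoo f fhat fp fhatp.
have mfh : cmeasurable fhat by case: fhatp => -[].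
have mn := measurable_normc mfh.
set C := (_ `^ b^-1)%R.
have C0 : 0 < C by rewrite powR_gt0.
have -> : (\int[pi]_chi ((normc (fhat chi) * psi chi `^ a) `^ b)%:E =
    \int[pi]_chi (normc (fhat chi) `^ b *
      psi chi `^ (1 - b / (p / (p - 1))))%:E)%E.
  apply: eq_integral => chi _; rewrite powRM ?powR_ge0 ?normc_ge0//.
  by rewrite -powRrM /a mulrBl mulVf ?gt_eqF// [_^-1 * b]mulrC.
have supE t : 0 < t -> (t%:E * pi [set chi | (t <= psi chi)%R] <= weak_sup pi psi)%E.
  by move=> t0; apply: ereal_sup_ubound; exists t.
have sup0 : (0 <= weak_sup pi psi)%E.
  by apply: le_trans (supE 1 ltr01); rewrite mule_ge0.
have F0 : (0 <= cnorm lambda p f)%E by exact: Lnorm_ge0.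
have Ffin : cnorm lambda p f \is a fin_num by rewrite ge0_fin_numE//; case: fp.
have Mfin : weak_sup pi psi \is a fin_num by rewrite ge0_fin_numE.
have [supE0|supn0] := eqVneq (weak_sup pi psi) 0%E.
  rewrite (@integral_weak_sup0 _ _ _ pi psi)//.
  - by rewrite poweR0r ?invr_eq0 ?gt_eqF// !mule_ge0 ?poweR_ge0// lee_fin ltW.
  - by solve_measurable.
  - by move=> chi; rewrite mulr_ge0 ?powR_ge0.
  move=> t t0; apply/eqP; rewrite eq_le measure_ge0 andbT.
  by have := supE t t0; rewrite supE0 pmule_rle0 ?lte_fin.
pose M := fine (weak_sup pi psi).
have ME : weak_sup pi psi = M%:E by rewrite fineK.
have M0 : 0 < M by rewrite -lte_fin -ME lt_neqAle eq_sym supn0.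
rewrite ME poweR_EFin -(fineK Ffin); set F := fine _.
have Fge0 : 0 <= F by rewrite fine_ge0.
have CM0 : 0 < C * M `^ a by rewrite mulr_gt0 ?powR_gt0.
(* [N] exceeds the norm of [f] by the amount that adds exactly [e] to the bound. *)
apply/lee_addgt0Pr => e e0.
pose N := F + e / (C * M `^ a).
have eN : 0 < e / (C * M `^ a) by rewrite divr_gt0.
have N0 : 0 < N by rewrite ltr_wpDl.
have FN : (cnorm lambda p f < N%:E)%E by rewrite -(fineK Ffin) lte_fin ltrDl.
rewrite ME in supE.
have key := fourier_Lp_weighted_le radonl plan p1 p2 pb bq M0 N0 mpsi psi0 supE
  fp fhatp FN.
apply: (@le_trans _ _ (C * M `^ a * N)%:E); last first.
  by rewrite -!EFinM -EFinD lee_fin /N mulrDr mulrCA divff ?gt_eqF// mulr1.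
have -> : C * M `^ a * N =
    (2 `^ b * (fourier_const p * M `^ (1 - b / (p / (p - 1))) * N `^ b)) `^ b^-1.
  rewrite !mulrA (@powRM _ (_ * M `^ _)) ?mulr_ge0 ?powR_ge0 ?(ltW A0)//.
    rewrite (@powRM _ (_ * fourier_const p)) ?powR_ge0 ?(ltW A0)//.
    rewrite -!powRrM mulfV ?gt_eqF// powRr1 ?(ltW N0)//.
    by congr (_ * _ `^ _ * _); rewrite /a; field; lra.
  by apply/ltW/fourier_const_gt0.
rewrite -poweR_EFin; apply: gt0_ler_poweR; rewrite ?invr_ge0 ?(ltW b0)//.
- rewrite in_itv/= leey andbT.
  by apply: integral_ge0 => chi _; rewrite lee_fin mulr_ge0 ?powR_ge0.
- rewrite in_itv/= leey andbT lee_fin !mulr_ge0 ?powR_ge0//.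
  exact/ltW/fourier_const_gt0.
Qed.
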